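(* Let $P=(\mathcal{T},\mathcal{C}:A)$ and $Q=(\mathcal{S},\mathcal{D}:B)$ be measuring left $\alpha$-pairings and let $$(\xi,\theta:\beta):(\mathcal{T},\mathcal{C}:A)\to(\mathcal{S},\mathcal{D}:B)$$ be a morphism of measuring left pairings. Then there is an isomorphism of functors $\mathbb{M}^{\mathcal{D}}\to\mathbb{M}^{\mathcal{C}}$ $$\mathrm{Coind}_{\mathcal{D}}^{\mathcal{C}}(-)\simeq-\square_{\mathcal{D}}(B\otimes_A\mathcal{C}).$$ If moreover $\kappa_Q(\mathcal{S})\subseteq{}^{\ast}\mathcal{D}^{\ast}$, then there are isomorphisms of functors $$\mathrm{Coind}_{\mathcal{D}}^{\mathcal{C}}(-)\simeq-\square_{\mathcal{D}}(B\otimes_A\mathcal{C})\simeq\mathrm{Hom}_{\mathcal{S}^{op}-\mathcal{S}^{op}}(\mathcal{S}^{op},-\otimes_B(B\otimes_A\mathcal{C})).$$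
   Context: $R$ is a commutative ring with $1_R\neq0_R$; $A$, $B$ are arbitrary $R$-algebras. An $A$-ring is an $A$-bimodule $\mathcal{T}$ with $A$-bilinear associative multiplication $\mathcal{T}\otimes_A\mathcal{T}\to\mathcal{T}$ and unit $A\to\mathcal{T}$; morphisms are $A$-bilinear maps respecting multiplication and unit. Given an $R$-algebra morphism $\beta:A\to B$, $B$-modules, $B$-bimodules and $B$-rings are regarded as $A$-modules, $A$-bimodules and $A$-rings through $\beta$. Corings: an $A$-coring is an $A$-bimodule $\mathcal{C}$ with $A$-bilinear coassociative comultiplication $\Delta_{\mathcal{C}}:\mathcal{C}\to\mathcal{C}\otimes_A\mathcal{C}$, $c\mapsto\sum c_1\otimes_A c_2$, and $A$-bilinear counit $\varepsilon_{\mathcal{C}}:\mathcal{C}\to A$. A morphism of corings $(\theta:\beta):(\mathcal{C}:A)\to(\mathcal{D}:B)$ is an $R$-algebra morphism $\beta:A\to B$ with an $(A,A)$-bilinear map $\theta:\mathcal{C}\to\mathcal{D}$ such that $\chi\circ(\theta\otimes_A\theta)\circ\Delta_{\mathcal{C}}=\Delta_{\mathcal{D}}\circ\theta$ ($\chi:\mathcal{D}\otimes_A\mathcal{D}\to\mathcal{D}\otimes_B\mathcal{D}$ canonical) and $\varepsilon_{\mathcal{D}}\circ\theta=\beta\circ\varepsilon_{\mathcal{C}}$. $^{\ast}\mathcal{C}:=\mathrm{Hom}_{A-}(\mathcal{C},A)$ (left $A$-linear maps) is an $A$-ring with product $(f\star_l g)(c)=\sum g(c_1f(c_2))$ and unit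 $\varepsilon_{\mathcal{C}}$; $^{\ast}\mathcal{D}^{\ast}:=\mathrm{Hom}_{B-B}(\mathcal{D},B)\subseteq{}^{\ast}\mathcal{D}$ is the set of $B$-bilinear maps. Comodules: a right $\mathcal{C}$-comodule is a right $A$-module $M$ with a right $A$-linear coassociative coaction $M\to M\otimes_A\mathcal{C}$, $m\mapsto\sum m_{<0>}\otimes_A m_{<1>}$; $\mathbb{M}^{\mathcal{C}}$ is the category of counital right $\mathcal{C}$-comodules with colinear maps. Measuring pairings: a measuring left pairing $P=(\mathcal{T},\mathcal{C}:A)$ consists of an $A$-coring $\mathcal{C}$ and an $A$-ring $\mathcal{T}$ with a morphism of $A$-rings $\kappa_P:\mathcal{T}\to{}^{\ast}\mathcal{C}$; write $\langle t,c\rangle:=\kappa_P(t)(c)$. It is a measuring left $\alpha$-pairing if for every right $A$-module $M$ the map $M\otimes_A\mathcal{C}\to\mathrm{Hom}_{-A}(\mathcal{T},M)$, $\sum m_i\otimes_A c_i\mapsto[t\mapsto\sum m_i\langle t,c_i\rangle]$, is injective (then $_A\mathcal{C}$ is flat). A morphism $(\xi,\theta:\beta):(\mathcal{T},\mathcal{C}:A)\to(\mathcal{S},\mathcal{D}:B)$ consists of a morphism of corings $(\theta:\beta):(\mathcal{C}:A)\to(\mathcal{D}:B)$ and a morphism of $A$-rings $\xi:\mathcal{S}\to\mathcal{T}$ with $\langle s,\theta(c)\rangle=\beta(\langle\xi(s),c\rangle)$ for all $s\in\mathcal{S}$, $c\in\mathcal{C}$. Coinduction: for a unital right $\mathcal{T}$-module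 $M$, $\mathrm{Rat}^{\mathcal{C}}(M_{\mathcal{T}})$ is the set of $m\in M$ for which there is a (necessarily unique) $\sum m_i\otimes_A c_i\in M\otimes_A\mathcal{C}$ with $mt=\sum m_i\langle t,c_i\rangle$ for all $t\in\mathcal{T}$; it is a right $\mathcal{C}$-comodule via $m\mapsto\sum m_i\otimes_A c_i$. Right $\mathcal{D}$-comodules $N$ are right $\mathcal{S}$-modules via $ns=\sum n_{<0>}\langle s,n_{<1>}\rangle$. As part of the setting, $\mathcal{T}\otimes_A B$ is taken as a right $\mathcal{S}$-module through $(\sum t_i\otimes_A b_i)\leftharpoonup s:=\sum t_i\xi(s)\otimes_A b_i$, and $\mathrm{Hom}_{-\mathcal{S}}(\mathcal{T}\otimes_A B,N)$ is a right $\mathcal{T}$-module through $(\varphi\leftharpoonup\widetilde t)(\sum t_i\otimes_A b_i)=\varphi(\sum\widetilde t\,t_i\otimes_A b_i)$. Then $\mathrm{Coind}_{\mathcal{D}}^{\mathcal{C}}(N):=\mathrm{Rat}^{\mathcal{C}}(\mathrm{Hom}_{-\mathcal{S}}(\mathcal{T}\otimes_A B,N))$. Ad-induction functor: $B\otimes_A\mathcal{C}$ is a left $\mathcal{D}$-comodule by $B\otimes_A\mathcal{C}\to\mathcal{D}\otimes_B(B\otimes_A\mathcal{C})\simeq\mathcal{D}\otimes_A\mathcal{C}$, $b\otimes_A c\mapsto\sum b\theta(c_1)\otimes_A c_2$. For $N\in\mathbb{M}^{\mathcal{D}}$, $N\square_{\mathcal{D}}(B\otimes_A\mathcal{C})\subseteq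 N\otimes_B(B\otimes_A\mathcal{C})\simeq N\otimes_A\mathcal{C}$ is the set of $\sum n^i\otimes_A c^i$ with $\sum n^i\otimes_B\theta(c^i{}_1)\otimes_A c^i{}_2=\sum n^i{}_{<0>}\otimes_B n^i{}_{<1>}\otimes_A c^i$, a right $\mathcal{C}$-comodule by $\sum n^i\otimes_A c^i\mapsto\sum n^i\otimes_A c^i{}_1\otimes_A c^i{}_2$. Bimodule structure: $\mathcal{S}^{op}$ is the opposite ring of $\mathcal{S}$; for $N\in\mathbb{M}^{\mathcal{D}}$ and $X=B\otimes_A\mathcal{C}$ with left $\mathcal{D}$-coaction $x\mapsto\sum x_{<-1>}\otimes_B x_{<0>}$, $N\otimes_B X$ has the canonical $\mathcal{S}^{op}$-bimodule structure $s^{op}(n\otimes_B x)=\sum n_{<0>}\langle s,n_{<1>}\rangle\otimes_B x$, $(n\otimes_B x)s^{op}=\sum n\otimes_B\langle s,x_{<-1>}\rangle x_{<0>}$; $\mathrm{Hom}_{\mathcal{S}^{op}-\mathcal{S}^{op}}$ denotes bimodule maps. *)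

(* Defs.v *)
From HB Require Import structures.
From mathcomp Require Import all_boot all_algebra.
From mathcomp Require Import boolp.
Set Implicit Arguments.
Unset Strict Implicit.
Unset Printing Implicit Defensive.
Import GRing.Theory.
Local Open Scope ring_scope.
Local Open Scope quotient_scope.

(* MathComp's algType requires 1 != 0 and so excludes the zero algebra. *)
Record ralg (R : comNzRingType) := RAlg {
  ra_ring :> pzRingType;
  ra_str : {rmorphism R -> ra_ring};
  ra_central : forall r a, ra_str r * a = a * ra_str r }.

Definition ralg_mor (R : comNzRingType) (A B : ralg R)
    (beta : {rmorphism A -> B}) : Prop :=
  forall r, beta (ra_str A r) = ra_str B r.

Record rmod (A : pzRingType) := Rmod {
  rm_car :> zmodType;
  ract : rm_car -> A -> rm_car;
  ractDl : forall x y a, ract (x + y) a = ract x a + ract y a;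
  ractDr : forall x a b, ract x (a + b) = ract x a + ract x b;
  ract1 : forall x, ract x 1 = x;
  ractA : forall x a b, ract (ract x a) b = ract x (a * b) }.
Arguments ract {A r}.
Notation "x *< a" := (ract x a) (at level 40, left associativity) : ring_scope.

Record bimod (A B : pzRingType) := Bimod {
  bm_l :> lmodType A;
  bact : bm_l -> B -> bm_l;
  bactDl : forall x y b, bact (x + y) b = bact x b + bact y b;
  bactDr : forall x b c, bact x (b + c) = bact x b + bact x c;
  bact1 : forall x, bact x 1 = x;
  bactA : forall x b c, bact (bact x b) c = bact x (b * c);
  bactZ : forall a x b, bact (a *: x) b = a *: bact x b }.

Definition bm_r A B (X : bimod A B) : rmod B :=
  @Rmod B (bm_l X) (@bact A B X) (@bactDl A B X) (@bactDr A B X)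
    (@bact1 A B X) (@bactA A B X).
Coercion bm_r : bimod >-> rmod.
Canonical bm_r.

Definition rlinear (A : pzRingType) (M N : rmod A) (f : M -> N) : Prop :=
  (forall x y, f (x + y) = f x + f y) /\ (forall x a, f (x *< a) = f x *< a).

Definition llinear (A : pzRingType) (M N : lmodType A) (f : M -> N) : Prop :=
  (forall x y, f (x + y) = f x + f y) /\ (forall a x, f (a *: x) = a *: f x).

Definition bilin (A B : pzRingType) (X Y : bimod A B) (f : X -> Y) : Prop :=
  llinear f /\ rlinear (f : bm_r X -> bm_r Y).

Lemma morph0 (U V : zmodType) (f : U -> V) :
  (forall x y, f (x + y) = f x + f y) -> f 0 = 0.
Proof. by move=> fD; apply: (@addIr _ (f 0)); rewrite -fD !add0r. Qed.

Lemma morphN (U V : zmodType) (f : U -> V) :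
  (forall x y, f (x + y) = f x + f y) -> forall x, f (- x) = - f x.
Proof.
by move=> fD x; apply: (@addIr _ (f x)); rewrite -fD !addNr (morph0 fD).
Qed.

Lemma ract0l A (M : rmod A) (a : A) : (0 : M) *< a = 0.
Proof. exact: (morph0 (fun x y : M => ractDl x y a)). Qed.
Lemma ract0r A (M : rmod A) (x : M) : x *< 0 = 0.
Proof. exact: (morph0 (ractDr x)). Qed.
Lemma ractNl A (M : rmod A) (x : M) (a : A) : (- x) *< a = - (x *< a).
Proof. exact: (morphN (fun x y : M => ractDl x y a)). Qed.
Lemma ractN1 A (M : rmod A) (x : M) : x *< (- 1) = - x.
Proof. by rewrite (morphN (ractDr x)) ract1. Qed.

Definition reg (A : pzRingType) : bimod A A :=
  @Bimod A A A^o (fun x a : A => x * a)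
    (fun x y b => mulrDl (x : A) y b) (fun x b c => mulrDr (x : A) b c)
    (fun x => mulr1 (x : A)) (fun x b c => esym (mulrA (x : A) b c))
    (fun a x b => esym (mulrA (a : A) x b)).

Definition rreg (T : pzRingType) : rmod T := reg T.

Definition restr (A B : pzRingType) (beta : {rmorphism A -> B}) (V : Type) : Type := V.

Section Restr.
Variables (A B : pzRingType) (beta : {rmorphism A -> B}).
Section Lmod.
Variable V : lmodType B.
HB.instance Definition _ := GRing.Zmodule.copy (restr beta V) V.
Let sc (a : A) (x : restr beta V) : restr beta V := beta a *: (x : V).
Fact restr_scA a b v : sc a (sc b v) = sc (a * b) v.
Proof. by rewrite /sc scalerA rmorphM. Qed.
Fact restr_sc1 : left_id 1 sc. Proof. by move=> v; rewrite /sc rmorph1 scale1r. Qed.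
Fact restr_scDr : right_distributive sc +%R. Proof. by move=> a x y; exact: scalerDr. Qed.
Fact restr_scDl v : {morph sc^~ v : a b / a + b}.
Proof. by move=> a b; rewrite /sc rmorphD scalerDl. Qed.
HB.instance Definition _ := GRing.Zmodule_isLmodule.Build A (restr beta V)
  restr_scA restr_sc1 restr_scDr restr_scDl.
End Lmod.
Definition lrestr L (X : bimod B L) : bimod A L :=
  @Bimod A L (restr beta X) (@bact B L X) (@bactDl _ _ X) (@bactDr _ _ X)
    (@bact1 _ _ X) (@bactA _ _ X) (fun a x b => bactZ (beta a) (x : X) b).

Section Rrestr.
Variables (L : pzRingType) (X : bimod L B).
Let act (x : X) (a : A) : X := x *< beta a.
Fact rrestrDl x y a : act (x + y) a = act x a + act y a. Proof. exact: bactDl. Qed.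
Fact rrestrDr x a b : act x (a + b) = act x a + act x b.
Proof. by rewrite /act rmorphD [LHS]bactDr. Qed.
Fact rrestr1 x : act x 1 = x. Proof. by rewrite /act rmorph1 [LHS]bact1. Qed.
Fact rrestrA x a b : act (act x a) b = act x (a * b).
Proof. by rewrite /act rmorphM [LHS]bactA. Qed.
Fact rrestrZ l x a : act (l *: x) a = l *: act x a. Proof. exact: bactZ. Qed.
Definition rrestr : bimod L A := Bimod rrestrDl rrestrDr rrestr1 rrestrA rrestrZ.
End Rrestr.
End Restr.

Section Tensor.
Variables (A : pzRingType) (M : rmod A) (N : lmodType A).

(* The congruence on formal sums of pairs generated by the relations of a
   tensor product; formal opposites are unnecessary, since (- m, n) is
   opposite to (m, n). *)
Inductive tens_rel : seq (M * N) -> seq (M * N) -> Prop :=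
| tr_refl s : tens_rel s s
| tr_sym s t : tens_rel s t -> tens_rel t s
| tr_trans s t u : tens_rel s t -> tens_rel t u -> tens_rel s u
| tr_cat s s' t t' : tens_rel s s' -> tens_rel t t' -> tens_rel (s ++ t) (s' ++ t')
| tr_catC s t : tens_rel (s ++ t) (t ++ s)
| tr_addl m m' n : tens_rel [:: (m + m', n)] [:: (m, n); (m', n)]
| tr_addr m n n' : tens_rel [:: (m, n + n')] [:: (m, n); (m, n')]
| tr_zero n : tens_rel [:: (0, n)] [::]
| tr_bal m a n : tens_rel [:: (m *< a, n)] [:: (m, a *: n)].

Let rel_tens (s t : seq (M * N)) : bool := `[< tens_rel s t >].
Fact rel_tens_refl : reflexive rel_tens. Proof. by move=> s; apply/asboolP/tr_refl. Qed.
Fact rel_tens_sym : symmetric rel_tens.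
Proof. by move=> s t; apply/idP/idP => /asboolP/tr_sym/asboolP. Qed.
Fact rel_tens_trans : transitive rel_tens.
Proof. by move=> t s u /asboolP h /asboolP h'; apply/asboolP/(tr_trans h). Qed.
Canonical tens_equiv :=
  EquivRel rel_tens rel_tens_refl rel_tens_sym rel_tens_trans.

Definition tens : Type := {eq_quot tens_equiv}.
HB.instance Definition _ := Choice.on tens.
HB.instance Definition _ := EqQuotient.on tens.

Definition tpi (s : seq (M * N)) : tens := \pi_tens s.
Definition trepr (z : tens) : seq (M * N) := repr z.
Fact treprK z : tpi (trepr z) = z. Proof. exact: reprK. Qed.
Fact tens_piP s t : tens_rel s t <-> tpi s = tpi t.
Proof. by rewrite /tpi; split=> [h|/eqmodP/asboolP//]; apply/eqmodP/asboolP. Qed.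
Fact tens_reprP s : tens_rel (trepr (tpi s)) s.
Proof. by apply/tens_piP; rewrite treprK. Qed.

Let add (x y : tens) : tens := tpi (trepr x ++ trepr y).
Let opp (x : tens) : tens := tpi [seq (- p.1, p.2) | p <- trepr x].
Let add_pi s t : add (tpi s) (tpi t) = tpi (s ++ t).
Proof. by apply/tens_piP/tr_cat; exact: tens_reprP. Qed.
Let zero : tens := tpi [::].
Fact tens_addA : associative add.
Proof.
move=> x y z; rewrite -(treprK x) -(treprK y) -(treprK z).
by rewrite !add_pi catA.
Qed.
Fact tens_addC : commutative add.
Proof.
move=> x y; rewrite -(treprK x) -(treprK y) !add_pi.
by apply/tens_piP/tr_catC.
Qed.
Fact tens_add0 : left_id zero add.
Proof. by move=> x; rewrite -(treprK x) add_pi. Qed.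
Fact tens_addN : left_inverse zero opp add.
Proof.
move=> x; rewrite /opp -{2}(treprK x) add_pi; apply/tens_piP.
elim: (trepr x) => [|[m n] s IHs]; first exact: tr_refl.
apply: tr_trans (_ : tens_rel (((m,n)::s) ++ ((-m,n) :: [seq (- p.1, p.2) | p <- s])) _).
  exact: tr_catC.
apply: tr_trans (_ : tens_rel ([:: (m,n)] ++ ([:: (-m,n)] ++ (s ++ [seq (- p.1, p.2) | p <- s]))) _).
  rewrite -cat1s -catA; apply: tr_cat; first exact: tr_refl.
  rewrite -(cat1s (-m,n)) !catA; apply: tr_cat; last exact: tr_refl.
  exact: tr_catC.
rewrite catA -[X in tens_rel _ X]cats0; apply: tr_cat.
  apply: tr_trans (tr_sym (tr_addl m (-m) n)) _.
  by rewrite subrr; exact: tr_zero.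
by apply: tr_trans (tr_catC _ _) IHs.
Qed.
HB.instance Definition _ := GRing.isZmodule.Build tens
  tens_addA tens_addC tens_add0 tens_addN.

Fact tpiD s t : tpi s + tpi t = tpi (s ++ t). Proof. exact: add_pi. Qed.

Definition tpure (m : M) (n : N) : tens := tpi [:: (m, n)].

Definition balanced (G : zmodType) (f : M -> N -> G) : Prop :=
  [/\ forall m m' n, f (m + m') n = f m n + f m' n,
      forall m n n', f m (n + n') = f m n + f m n' &
      forall m a n, f (m *< a) n = f m (a *: n)].

(* The sum of the f m_i n_i for z = \sum_i m_i ⊗ n_i; it is independent of
   the chosen representation of z when f is balanced (tlift_pure, tliftD). *)
Definition tlift (G : zmodType) (f : M -> N -> G) (z : tens) : G :=
  \sum_(p <- trepr z) f p.1 p.2.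

Lemma tpure_balanced : balanced tpure.
Proof.
by split=> *; rewrite ?tpiD; apply/tens_piP;
  [exact: tr_addl|exact: tr_addr|exact: tr_bal].
Qed.

Lemma tpureDl m m' n : tpure (m + m') n = tpure m n + tpure m' n.
Proof. by case: tpure_balanced. Qed.
Lemma tpureDr m n n' : tpure m (n + n') = tpure m n + tpure m n'.
Proof. by case: tpure_balanced. Qed.
Lemma tpureA m a n : tpure (m *< a) n = tpure m (a *: n).
Proof. by case: tpure_balanced. Qed.

Section Lift.
Variables (G : zmodType) (f : M -> N -> G).
Hypothesis hf : balanced f.
Let tlift_pi s : tlift f (tpi s) = \sum_(p <- s) f p.1 p.2.
Proof.
have [fDl fDr fA] := hf.
suff h t u : tens_rel t u -> \sum_(p <- t) f p.1 p.2 = \sum_(p <- u) f p.1 p.2.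
  exact/h/tens_reprP.
elim=> {t u} //=.
- by move=> t1 t2 t3 _ -> _ ->.
- by move=> t1 t1' t2 t2' _ h _ h'; rewrite !big_cat /= h h'.
- by move=> t1 t2; rewrite !big_cat /= addrC.
- by move=> m m' n; rewrite !(big_cons, big_nil) /= !addr0.
- by move=> m n n'; rewrite !(big_cons, big_nil) /= !addr0.
- by move=> n; rewrite !(big_cons, big_nil) /= addr0 (morph0 (fun x y => fDl x y n)).
- by move=> m a n; rewrite !(big_cons, big_nil) /= fA.
Qed.
Lemma tlift_pure m n : tlift f (tpure m n) = f m n.
Proof. by rewrite tlift_pi big_cons big_nil addr0. Qed.
Lemma tliftD x y : tlift f (x + y) = tlift f x + tlift f y.
Proof.
by rewrite -(treprK x) -(treprK y) tpiD !tlift_pi big_cat.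
Qed.
End Lift.

Lemma tens_ind (P : tens -> Prop) :
  (forall m n, P (tpure m n)) -> (forall x y, P x -> P y -> P (x + y)) ->
  forall z, P z.
Proof.
move=> Pp PD z; rewrite -(treprK z).
have e : tpure 0 0 = 0 by apply: (@addIr _ (tpure 0 0)); rewrite -tpureDl !add0r.
have P0 : P 0 by rewrite -e; exact: Pp.
elim: (trepr z) => [|[m n] s IHs]; first exact: P0.
by rewrite -cat1s -tpiD; apply: PD => //; exact: Pp.
Qed.

Lemma tens_ext (G : zmodType) (f g : tens -> G) :
  (forall x y, f (x + y) = f x + f y) -> (forall x y, g (x + y) = g x + g y) ->
  (forall m n, f (tpure m n) = g (tpure m n)) -> forall z, f z = g z.
Proof. by move=> fD gD h; elim/tens_ind => [//|x y hx hy]; rewrite fD gD hx hy. Qed.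
End Tensor.
Arguments tpure {A M N}.
Notation "m ⊗ n" := (tpure m n) (at level 39, left associativity) : ring_scope.

Lemma rlin_id A (M : rmod A) : rlinear (@id M). Proof. by []. Qed.
Lemma llin_id A (M : lmodType A) : llinear (@id M). Proof. by []. Qed.
Lemma rlin_comp A (M N P : rmod A) (f : N -> P) (g : M -> N) :
  rlinear f -> rlinear g -> rlinear (f \o g).
Proof. by case=> fD fZ [gD gZ]; split=> x y /=; rewrite (gD, gZ) (fD, fZ). Qed.
Lemma llin_comp A (M N P : lmodType A) (f : N -> P) (g : M -> N) :
  llinear f -> llinear g -> llinear (f \o g).
Proof. by case=> fD fZ [gD gZ]; split=> x y /=; rewrite (gD, gZ) (fD, fZ). Qed.

Section TensorMap.
Variables (A : pzRingType) (M M' : rmod A) (N N' : lmodType A).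
Variables (f : M -> M') (g : N -> N').
Definition tmap : tens M N -> tens M' N' := tlift (fun m n => f m ⊗ g n).
Hypotheses (hf : rlinear f) (hg : llinear g).
Lemma tmap_balanced : balanced (fun m n => f m ⊗ g n).
Proof.
case: hf hg => [fD fZ] [gD gZ]; split=> *.
- by rewrite fD tpureDl.
- by rewrite gD tpureDr.
- by rewrite fZ gZ tpureA.
Qed.
Lemma tmapD x y : tmap (x + y) = tmap x + tmap y.
Proof. exact: (tliftD tmap_balanced). Qed.
Lemma tmapE m n : tmap (m ⊗ n) = f m ⊗ g n.
Proof. exact: (tlift_pure tmap_balanced). Qed.
End TensorMap.

Section TensorLeft.
Variables (A B : pzRingType) (X : bimod B A) (N : lmodType A).
Let sc (b : B) (z : tens X N) : tens X N := tmap (fun x : X => b *: x : X) id z.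
Let scP (b : B) : rlinear (fun x : X => b *: x : X).
Proof. by split=> x y; [exact: scalerDr | exact: esym (bactZ _ _ _)]. Qed.
Let scE b x n : sc b (x ⊗ n) = (b *: x) ⊗ n.
Proof. exact: (tmapE (scP b) (@llin_id _ _)). Qed.
Fact tens_scDr : right_distributive sc +%R.
Proof. by move=> b x y; exact: (tmapD (scP b) (@llin_id _ _)). Qed.
Fact tens_scA a b v : sc a (sc b v) = sc (a * b) v.
Proof.
by elim/tens_ind: v => [x n|x y hx hy]; rewrite ?tens_scDr ?hx ?hy // !scE scalerA.
Qed.
Fact tens_sc1 : left_id 1 sc.
Proof.
by elim/tens_ind => [x n|x y hx hy]; rewrite ?tens_scDr ?hx ?hy // scE scale1r.
Qed.
Fact tens_scDl v : {morph sc^~ v : a b / a + b}.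
Proof.
move=> a b; elim/tens_ind: v => [x n|x y hx hy]; last by rewrite !tens_scDr hx hy addrACA.
by rewrite !scE scalerDl tpureDl.
Qed.
HB.instance Definition _ := GRing.Zmodule_isLmodule.Build B (tens X N)
  tens_scA tens_sc1 tens_scDr tens_scDl.
Lemma tens_scaleE (b : B) (x : X) (n : N) :
  b *: (x ⊗ n : tens X N) = (b *: x) ⊗ n.
Proof. exact: scE. Qed.
End TensorLeft.

Section TensorRight.
Variables (A B : pzRingType) (M : rmod A) (Y : bimod A B).
Let act (z : tens M Y) (b : B) : tens M Y := tmap id (fun y => bact y b) z.
Let actP (b : B) : llinear (fun y : Y => bact y b).
Proof. by split=> x y; [exact: bactDl | exact: bactZ]. Qed.
Let actE m y b : act (m ⊗ y) b = m ⊗ bact y b.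
Proof. exact: (tmapE (@rlin_id _ _) (actP b)). Qed.
Fact tens_actDl x y b : act (x + y) b = act x b + act y b.
Proof. exact: (tmapD (@rlin_id _ _) (actP b)). Qed.
Fact tens_actDr x a b : act x (a + b) = act x a + act x b.
Proof.
elim/tens_ind: x => [m n|x y hx hy]; last by rewrite !tens_actDl hx hy addrACA.
by rewrite !actE bactDr tpureDr.
Qed.
Fact tens_act1 x : act x 1 = x.
Proof.
by elim/tens_ind: x => [m n|x y hx hy]; rewrite ?tens_actDl ?hx ?hy // actE bact1.
Qed.
Fact tens_actA x a b : act (act x a) b = act x (a * b).
Proof.
by elim/tens_ind: x => [m n|x y hx hy]; rewrite ?tens_actDl ?hx ?hy // !actE bactA.
Qed.
Definition tens_r : rmod B := Rmod tens_actDl tens_actDr tens_act1 tens_actA.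
Canonical tens_r.
Lemma tens_actE (m : M) (y : Y) (b : B) :
  @ract B tens_r (m ⊗ y) b = m ⊗ (y *< b).
Proof. exact: actE. Qed.
End TensorRight.

Section TensorBimod.
Variables (A B C : pzRingType) (X : bimod B A) (Y : bimod A C).
Fact tens_actZ (b : B) (z : tens X Y) (c : C) :
  @ract C (tens_r X Y) (b *: z) c = b *: @ract C (tens_r X Y) z c.
Proof.
elim/tens_ind: z => [x y|x y hx hy]; last by rewrite scalerDr !ractDl scalerDr hx hy.
by rewrite tens_scaleE !tens_actE tens_scaleE.
Qed.
Definition tens_b : bimod B C :=
  @Bimod B C (tens X Y) (@ract C (tens_r X Y)) (@tens_actDl _ _ X Y)
    (@tens_actDr _ _ X Y) (@tens_act1 _ _ X Y) (@tens_actA _ _ X Y) tens_actZ.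
End TensorBimod.

Section TensorAssoc.
Variables (A B : pzRingType) (M : rmod A) (Y : bimod A B) (N : lmodType B).

Definition tassoc : tens (tens_r M Y) N -> tens M (tens Y N) :=
  tlift (fun (w : tens_r M Y) n => tmap id (fun y : Y => (y ⊗ n : tens Y N)) w).
Definition tassocV : tens M (tens Y N) -> tens (tens_r M Y) N :=
  tlift (fun m (w : tens Y N) =>
    tmap (fun y => (m ⊗ y : tens_r M Y)) id w).

Let purel (n : N) : llinear (fun y : Y => (y ⊗ n : tens Y N)).
Proof. by split=> x y; rewrite ?tpureDl ?tens_scaleE. Qed.
Let purer (m : M) : rlinear (fun y : bm_r Y => (m ⊗ y : tens_r M Y)).
Proof. by split=> x y; [exact: tpureDr | rewrite tens_actE]. Qed.

Fact tassoc_bal : balanced (fun (w : tens_r M Y) n =>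
  tmap id (fun y : Y => (y ⊗ n : tens Y N)) w).
Proof.
split.
- by move=> m m' n; exact: (tmapD (@rlin_id _ _) (purel n)).
- move=> w n n'; elim/tens_ind: w => [m y|x y hx hy].
    by rewrite !(tmapE (@rlin_id _ _) (purel _)) !tpureDr.
  by rewrite !(tmapD (@rlin_id _ _) (purel _)) hx hy addrACA.
- move=> w b n; elim/tens_ind: w => [m y|x y hx hy].
    by rewrite tens_actE !(tmapE (@rlin_id _ _) (purel _)) tpureA.
  by rewrite ractDl !(tmapD (@rlin_id _ _) (purel _)) hx hy.
Qed.
Fact tassocV_bal : balanced (fun m (w : tens Y N) =>
  tmap (fun y => (m ⊗ y : tens_r M Y)) id w).
Proof.
split.
- move=> m m' w; elim/tens_ind: w => [y n|x y hx hy].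
    by rewrite !(tmapE (purer _) (@llin_id _ _)) !tpureDl.
  by rewrite !(tmapD (purer _) (@llin_id _ _)) hx hy addrACA.
- by move=> m w w'; exact: (tmapD (purer _) (@llin_id _ _)).
- move=> m a w; elim/tens_ind: w => [y n|x y hx hy].
    by rewrite tens_scaleE !(tmapE (purer _) (@llin_id _ _)) tpureA.
  by rewrite scalerDr !(tmapD (purer _) (@llin_id _ _)) hx hy.
Qed.
Lemma tassocD x y : tassoc (x + y) = tassoc x + tassoc y.
Proof. exact: (tliftD tassoc_bal). Qed.
Lemma tassocVD x y : tassocV (x + y) = tassocV x + tassocV y.
Proof. exact: (tliftD tassocV_bal). Qed.
Lemma tassocE (m : M) (y : Y) (n : N) :
  tassoc ((m ⊗ y : tens_r M Y) ⊗ n) = m ⊗ (y ⊗ n : tens Y N).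
Proof. by rewrite /tassoc (tlift_pure tassoc_bal) (tmapE (@rlin_id _ _) (purel _)). Qed.
Lemma tassocVE (m : M) (y : Y) (n : N) :
  tassocV (m ⊗ (y ⊗ n : tens Y N)) = (m ⊗ y : tens_r M Y) ⊗ n.
Proof. by rewrite /tassocV (tlift_pure tassocV_bal) (tmapE (purer _) (@llin_id _ _)). Qed.

Lemma tens3_ind (P : tens M (tens Y N) -> Prop) :
  (forall m y n, P (m ⊗ (y ⊗ n : tens Y N))) ->
  (forall x y, P x -> P y -> P (x + y)) -> forall z, P z.
Proof.
move=> Pp PD; elim/tens_ind => // m w.
by elim/tens_ind: w => // x y hx hy; rewrite tpureDr; exact: PD.
Qed.
Lemma tens3l_ind (P : tens (tens_r M Y) N -> Prop) :
  (forall m y n, P ((m ⊗ y : tens_r M Y) ⊗ n)) ->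
  (forall x y, P x -> P y -> P (x + y)) -> forall z, P z.
Proof.
move=> Pp PD; elim/tens_ind => // w n.
by elim/tens_ind: w => // x y hx hy; rewrite tpureDl; exact: PD.
Qed.
Lemma tassocVK z : tassoc (tassocV z) = z.
Proof.
by elim/tens3_ind: z => [m y n|x y hx hy]; rewrite ?tassocVE ?tassocE // tassocVD tassocD hx hy.
Qed.
End TensorAssoc.

Record aring (A : pzRingType) := ARing {
  ar_bim :> bimod A A;
  ar_mul : ar_bim -> ar_bim -> ar_bim;
  ar_unit : A -> ar_bim;
  ar_mul_bal : balanced (M := bm_r ar_bim) (N := bm_l ar_bim) ar_mul;
  ar_mulZ : forall a t u, ar_mul (a *: t) u = a *: ar_mul t u;
  ar_mulR : forall t u a, ar_mul t (u *< a) = ar_mul t u *< a;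
  ar_mulA : forall t u v, ar_mul t (ar_mul u v) = ar_mul (ar_mul t u) v;
  ar_unit_bilin : bilin (ar_unit : reg A -> ar_bim);
  ar_mul1l : forall t, ar_mul (ar_unit 1) t = t;
  ar_mul1r : forall t, ar_mul t (ar_unit 1) = t }.

Definition ring_of (A : pzRingType) (T : aring A) : Type := T.
Section RingOf.
Variables (A : pzRingType) (T : aring A).
HB.instance Definition _ := GRing.Zmodule.copy (ring_of T) (ar_bim T).
Fact ring_of_mulDl : left_distributive (@ar_mul A T) +%R.
Proof. by case: (ar_mul_bal T) => h _ _ x y z; exact: h. Qed.
Fact ring_of_mulDr : right_distributive (@ar_mul A T) +%R.
Proof. by case: (ar_mul_bal T) => _ h _ x y z; exact: h. Qed.
HB.instance Definition _ := GRing.Zmodule_isPzRing.Build (ring_of T)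
  (@ar_mulA A T) (@ar_mul1l A T) (@ar_mul1r A T) ring_of_mulDl ring_of_mulDr.
End RingOf.

Record aring_mor (A : pzRingType) (T U : aring A) (f : T -> U) : Prop := {
  arm_bilin : bilin f;
  arm_mul : forall t u, f (ar_mul t u) = ar_mul (f t) (f u);
  arm_unit : forall a, f (ar_unit T a) = ar_unit U a }.

Lemma ar_mul_ract A (T : aring A) (t u : T) (a : A) :
  ar_mul (t *< a) u = ar_mul t (a *: u).
Proof. by case: (ar_mul_bal T). Qed.
Lemma ar_unitE A (T : aring A) (a : A) : ar_unit T a = a *: ar_unit T 1.
Proof.
have [[_ uZ] _] := ar_unit_bilin T.
by rewrite -uZ; congr ar_unit; exact: esym (mulr1 _).
Qed.
Lemma ar_unitR A (T : aring A) (a : A) : ar_unit T a = ar_unit T 1 *< a.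
Proof.
have [_ [_ uZ]] := ar_unit_bilin T.
by rewrite -uZ; congr ar_unit; exact: esym (mul1r _).
Qed.
Lemma ar_mul_unitl A (T : aring A) (a : A) (t : T) : ar_mul (ar_unit T a) t = a *: t.
Proof. by rewrite ar_unitE ar_mulZ ar_mul1l. Qed.
Lemma ar_mul_unitr A (T : aring A) (a : A) (t : T) : ar_mul t (ar_unit T a) = t *< a.
Proof. by rewrite ar_unitR ar_mulR ar_mul1r. Qed.

Section RestrRing.
Variables (A B : pzRingType) (beta : {rmorphism A -> B}) (S : aring B).
Let X := lrestr beta (rrestr beta S).
Fact restr_aring_bal : balanced (M := bm_r X) (N := bm_l X) (@ar_mul B S).
Proof.
by case: (ar_mul_bal S) => h1 h2 h3; split=> // s a s'; exact: (h3 s (beta a) s').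
Qed.
Fact restr_aring_unit :
  bilin ((fun a => ar_unit S (beta a)) : reg A -> X).
Proof.
case: (ar_unit_bilin S) => -[uD uZ] [_ uR]; split; split=> x y.
- by rewrite rmorphD; exact: uD.
- by rewrite rmorphM; exact: (uZ (beta x) (beta y)).
- by rewrite rmorphD; exact: uD.
- by rewrite rmorphM; exact: (uR (beta x) (beta y)).
Qed.
Fact restr_aring_1l (s : X) : ar_mul (ar_unit S (beta 1)) s = s.
Proof. by rewrite rmorph1 ar_mul1l. Qed.
Fact restr_aring_1r (s : X) : ar_mul s (ar_unit S (beta 1)) = s.
Proof. by rewrite rmorph1 ar_mul1r. Qed.
Definition restr_aring : aring A :=
  @ARing A X (@ar_mul B S) (fun a => ar_unit S (beta a)) restr_aring_bal
    (fun a t u => ar_mulZ (beta a) t u) (fun t u a => ar_mulR t u (beta a))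
    (@ar_mulA B S) restr_aring_unit restr_aring_1l restr_aring_1r.
End RestrRing.

(* Right modules over an A-ring, viewed as right A-modules through the unit. *)
Section Rres.
Variables (A : pzRingType) (T : aring A) (M : rmod (ring_of T)).
Let act (x : M) (a : A) : M := x *< (ar_unit T a : ring_of T).
Fact rresDl x y a : act (x + y) a = act x a + act y a. Proof. exact: ractDl. Qed.
Fact rresDr x a b : act x (a + b) = act x a + act x b.
Proof. by rewrite /act; case: (ar_unit_bilin T) => -[-> _] _; exact: ractDr. Qed.
Fact rres1 x : act x 1 = x. Proof. exact: ract1. Qed.
Fact rresA x a b : act (act x a) b = act x (a * b).
Proof.
rewrite /act ractA; congr (_ *< _).
by rewrite [LHS]ar_mul_unitl; case: (ar_unit_bilin T) => -[_ h] _; rewrite -h.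
Qed.
Definition rres : rmod A := Rmod rresDl rresDr rres1 rresA.
End Rres.

(* ev f (\sum_i m_i ⊗ c_i) = \sum_i m_i f(c_i) *)
Definition ev (A : pzRingType) (M : rmod A) (C : lmodType A) (f : C -> A)
  : tens M C -> M := tlift (fun m c => m *< f c).

Record coring (A : pzRingType) := Coring {
  co_bim :> bimod A A;
  Delta : co_bim -> tens co_bim co_bim;
  eps : co_bim -> A;
  Delta_bilin : bilin (Delta : co_bim -> tens_b co_bim co_bim);
  eps_bilin : bilin (eps : co_bim -> reg A);
  coassoc : forall c, tassoc (tmap (M' := tens_r co_bim co_bim) Delta id (Delta c))
    = tmap id Delta (Delta c);
  counitl : forall c, tlift (fun c1 c2 : co_bim => eps c1 *: c2) (Delta c) = c;
  counitr : forall c, ev eps (Delta c) = c }.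

Record ldual (A : pzRingType) (C : lmodType A) := Ldual {
  ld_fun :> C -> A;
  ldP : llinear (ld_fun : C -> A^o) }.

Lemma ldual_eq A (C : lmodType A) (f g : ldual C) : f =1 g -> f = g.
Proof.
case: f g => f hf [g hg] /= /funext e; subst g.
by congr Ldual; exact: Prop_irrelevance.
Qed.

Section Ev.
Variables (A : pzRingType) (M : rmod A) (C : lmodType A).
Lemma ev_balanced (f : ldual C) : balanced (fun (m : M) c => m *< f c).
Proof.
have [fD fZ] := ldP f; split=> *; first exact: ractDl.
- by rewrite fD ractDr.
- by rewrite fZ ractA.
Qed.
Lemma evD (f : ldual C) (x y : tens M C) : ev f (x + y) = ev f x + ev f y.
Proof. exact: (tliftD (ev_balanced f)). Qed.
Lemma evE (f : ldual C) (m : M) c : ev f (m ⊗ c) = m *< f c.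
Proof. exact: (tlift_pure (ev_balanced f)). Qed.
End Ev.

Lemma ev_tmap A (M M' : rmod A) (C C' : lmodType A) (h : M -> M') (k : C -> C')
    (f : ldual C') (g : ldual C) (z : tens M C) :
  rlinear h -> llinear k -> (forall c, f (k c) = g c) ->
  ev f (tmap h k z) = h (ev g z).
Proof.
move=> hh hk e; elim/tens_ind: z => [m c|x y hx hy].
  by rewrite (tmapE hh hk) !evE e (proj2 hh).
by rewrite (tmapD hh hk) !evD (proj1 hh) hx hy.
Qed.

Lemma ev_ract A (M : rmod A) (C : bimod A A) (f g : ldual C) (a : A)
    (z : tens_r M C) : (forall c, f (c *< a) = g c) -> ev f (z *< a) = ev g z.
Proof.
move=> e; elim/tens_ind: z => [m c|x y hx hy].
  by rewrite tens_actE !evE e.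
by rewrite ractDl !evD hx hy.
Qed.

Section LdualRing.
Variables (A : pzRingType) (C : coring A).
HB.instance Definition _ := gen_eqMixin (ldual C).
HB.instance Definition _ := gen_choiceMixin (ldual C).

Lemma ldD (f : ldual C) x y : f (x + y) = f x + f y. Proof. by case: (ldP f). Qed.
Lemma ldZ (f : ldual C) a x : f (a *: x) = a * f x. Proof. by case: (ldP f). Qed.

Fact ldual_addP (f g : ldual C) : llinear ((fun c => f c + g c) : C -> A^o).
Proof. by split=> x y; [rewrite !ldD addrACA | rewrite !ldZ -mulrDr]. Qed.
Fact ldual_oppP (f : ldual C) : llinear ((fun c => - f c) : C -> A^o).
Proof. by split=> x y; [rewrite ldD opprD | rewrite ldZ -mulrN]. Qed.
Fact ldual_zeroP : llinear ((fun => 0) : C -> A^o).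
Proof. by split=> x y; rewrite ?addr0 ?scaler0. Qed.
Let add f g := Ldual (ldual_addP f g).
Let opp f := Ldual (ldual_oppP f).
Let zero := Ldual ldual_zeroP.
Fact ldual_addA : associative add.
Proof. by move=> f g h; apply: ldual_eq => c; exact: addrA. Qed.
Fact ldual_addC : commutative add.
Proof. by move=> f g; apply: ldual_eq => c; exact: addrC. Qed.
Fact ldual_add0 : left_id zero add.
Proof. by move=> f; apply: ldual_eq => c; exact: add0r. Qed.
Fact ldual_addN : left_inverse zero opp add.
Proof. by move=> f; apply: ldual_eq => c; exact: addNr. Qed.
HB.instance Definition _ := GRing.isZmodule.Build (ldual C)
  ldual_addA ldual_addC ldual_add0 ldual_addN.

Fact ldual_lP a (f : ldual C) : llinear ((fun c => f (c *< a)) : C -> A^o).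
Proof.
split=> x y; first by rewrite ractDl ldD.
by rewrite -[RHS]ldZ; congr (f _); exact: bactZ.
Qed.
Fact ldual_rP (f : ldual C) a : llinear ((fun c => f c * a) : C -> A^o).
Proof. by split=> x y; [rewrite ldD mulrDl | rewrite ldZ -mulrA]. Qed.
Let sc a f : ldual C := Ldual (ldual_lP a f).
Let act f a : ldual C := Ldual (ldual_rP f a).
Fact ldual_scA a b f : sc a (sc b f) = sc (a * b) f.
Proof. by apply: ldual_eq => c /=; rewrite ractA. Qed.
Fact ldual_sc1 : left_id 1 sc.
Proof. by move=> f; apply: ldual_eq => c /=; rewrite ract1. Qed.
Fact ldual_scDr : right_distributive sc +%R.
Proof. by move=> a f g; exact: ldual_eq. Qed.
Fact ldual_scDl f : {morph sc^~ f : a b / a + b}.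
Proof. by move=> a b; apply: ldual_eq => c /=; rewrite ractDr ldD. Qed.
HB.instance Definition _ := GRing.Zmodule_isLmodule.Build A (ldual C)
  ldual_scA ldual_sc1 ldual_scDr ldual_scDl.
Fact ldual_actDl f g a : act (f + g) a = act f a + act g a.
Proof. by apply: ldual_eq => c; exact: mulrDl. Qed.
Fact ldual_actDr f a b : act f (a + b) = act f a + act f b.
Proof. by apply: ldual_eq => c; exact: mulrDr. Qed.
Fact ldual_act1 f : act f 1 = f.
Proof. by apply: ldual_eq => c; exact: mulr1. Qed.
Fact ldual_actA f a b : act (act f a) b = act f (a * b).
Proof. by apply: ldual_eq => c; exact: esym (mulrA _ _ _). Qed.
Fact ldual_actZ a f b : act (a *: f) b = a *: act f b.
Proof. exact: ldual_eq. Qed.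
Definition ldual_b : bimod A A :=
  Bimod ldual_actDl ldual_actDr ldual_act1 ldual_actA ldual_actZ.

Lemma Delta_l : llinear (@Delta A C). Proof. by case: (Delta_bilin C). Qed.
Lemma Delta_r : rlinear (@Delta A C : C -> tens_r C C).
Proof. by case: (Delta_bilin C). Qed.

Lemma ev_llin (f : ldual C) : llinear (fun z : tens C C => ev f z : C).
Proof.
split=> [|a z]; first exact: evD.
elim/tens_ind: z => [c d|x y hx hy]; last by rewrite scalerDr !evD hx hy scalerDr.
by rewrite tens_scaleE !evE; exact: bactZ.
Qed.

(* (f * g)(c) = \sum g(c_1 f(c_2)) *)
Definition lstar_fun (f g : ldual C) (c : C) : A := g (ev f (Delta c)).
Fact lstarP f g : llinear (lstar_fun f g : C -> A^o).
Proof.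
rewrite /lstar_fun; have [DD DZ] := Delta_l; have [eD eZ] := ev_llin f.
by split=> x y; rewrite (DD, DZ) (eD, eZ) (ldD, ldZ).
Qed.
Definition lstar f g : ldual C := Ldual (lstarP f g).

Definition ldual_unit (a : A) : ldual C.
Proof.
exists (fun c => eps c * a).
by have [[eD eZ] _] := eps_bilin C; split=> x y; [rewrite eD; exact: mulrDl | rewrite eZ; exact: esym (mulrA _ _ _)].
Defined.

Lemma ev_ev (M : rmod A) (f g fg : ldual C) (z : tens (tens_r M C) C)
    (w : tens M C) : tassoc z = tmap id (@Delta A C) w -> lstar f g =1 fg ->
  ev g (ev f z : tens M C) = ev fg w.
Proof.
move=> e efg.
have hP : llinear ((fun v : tens C C => g (ev f v)) : tens C C -> A^o).
  by have [eD eZ] := ev_llin f; split=> x y; rewrite (eD, eZ) (ldD, ldZ).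
pose h : ldual (tens C C) := Ldual hP.
transitivity (ev h (tassoc z)).
  elim/tens3l_ind: z {e} => [m c d|x y hx hy].
    by rewrite tassocE !evE tens_actE !evE /= evE.
  by rewrite tassocD !evD hx hy.
rewrite e; apply: (@ev_tmap _ _ _ _ _ id) => //; exact: Delta_l.
Qed.

Fact lstarA f g h : lstar f (lstar g h) = lstar (lstar f g) h.
Proof.
apply: ldual_eq => c /=; rewrite /lstar_fun; congr (h _) => /=.
rewrite -(@ev_ev C f g (lstar f g) _ _ (coassoc c)) //.
by congr (ev g _); apply/esym/(ev_tmap (h := @Delta A C : C -> tens_r C C)) => //;
  exact: Delta_r.
Qed.

Lemma ev_addf (M : rmod A) (f g : ldual C) (z : tens M C) :
  ev (f + g) z = ev f z + ev g z.
Proof.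
elim/tens_ind: z => [m c|x y hx hy]; first by rewrite !evE ractDr.
by rewrite !evD hx hy addrACA.
Qed.
Lemma ev_actf (M : rmod A) (f : ldual C) a (z : tens M C) :
  ev (act f a) z = ev f z *< a.
Proof.
elim/tens_ind: z => [m c|x y hx hy]; first by rewrite !evE ractA.
by rewrite !evD hx hy ractDl.
Qed.
Lemma ev_scf (M : rmod A) (f : ldual C) a (z : tens_r M C) :
  ev f (z *< a) = ev (sc a f) z.
Proof. exact: ev_ract. Qed.

Fact lstar_bal : balanced (M := bm_r ldual_b) (N := bm_l ldual_b) lstar.
Proof.
split=> [f f' g|f g g'|f a g]; apply: ldual_eq => c //=; rewrite /lstar_fun.
  by rewrite ev_addf ldD.
by rewrite ev_actf.
Qed.
Fact lstarZ a (f g : ldual_b) : lstar (a *: f) g = a *: lstar f g.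
Proof.
apply: ldual_eq => c /=; rewrite /lstar_fun.
by rewrite (proj2 Delta_r) ev_scf.
Qed.
Fact lstarR (f g : ldual_b) a : lstar f (g *< a) = (lstar f g : ldual_b) *< a.
Proof. exact: ldual_eq. Qed.
Fact ldual_unit_bilin : bilin (ldual_unit : reg A -> ldual_b).
Proof.
have [_ [_ eR]] := eps_bilin C.
split; split=> a b; apply: ldual_eq => c /=.
- by rewrite mulrDr.
- by rewrite eR; exact: mulrA.
- by rewrite mulrDr.
- exact: mulrA.
Qed.
Fact lstar1l f : lstar (ldual_unit 1) f = f.
Proof.
apply: ldual_eq => c /=; rewrite /lstar_fun; congr (f _).
rewrite -[RHS]counitr; elim/tens_ind: (Delta c) => [c1 c2|x y hx hy].
  by rewrite evE /= mulr1 (evE (Ldual (proj1 (eps_bilin C)))).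
by rewrite evD hx hy (evD (Ldual (proj1 (eps_bilin C)))).
Qed.
Fact lstar1r f : lstar f (ldual_unit 1) = f.
Proof.
apply: ldual_eq => c /=; rewrite /lstar_fun /= mulr1 -[in RHS](counitl c).
have [[eD eZ] [_ eR]] := eps_bilin C.
have hb : balanced (fun c1 c2 : C => eps c1 *: c2).
  split=> *; first by rewrite eD scalerDl.
  - exact: scalerDr.
  - by rewrite eR scalerA.
elim/tens_ind: (Delta c) => [c1 c2|x y hx hy].
  by rewrite evE (tlift_pure hb) ldZ eR.
by rewrite evD eD hx hy (tliftD hb) ldD.
Qed.
Definition ldual_aring : aring A :=
  @ARing A ldual_b lstar ldual_unit lstar_bal lstarZ lstarR lstarA
    ldual_unit_bilin lstar1l lstar1r.
End LdualRing.

Record pairing (A : pzRingType) := Pairing {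
  pr_T : aring A;
  pr_C : coring A;
  kappa : pr_T -> ldual_aring pr_C;
  kappaP : aring_mor kappa }.

(* <t, c> *)
Definition pr (A : pzRingType) (P : pairing A) (t : pr_T P) : ldual (pr_C P) :=
  kappa t.

Definition alpha_pairing (A : pzRingType) (P : pairing A) : Prop :=
  forall M : rmod A,
    injective (fun (z : tens M (pr_C P)) (t : pr_T P) => ev (pr t) z).

(* The canonical map D ⊗_A D -> D ⊗_B D. *)
Definition chi (A B : pzRingType) (beta : {rmorphism A -> B}) (D : bimod B B) :
    tens (lrestr beta (rrestr beta D)) (lrestr beta (rrestr beta D)) -> tens D D :=
  tlift (M := lrestr beta (rrestr beta D)) (N := lrestr beta (rrestr beta D))
    (fun d d' : D => d ⊗ d').
Arguments chi {A B beta D}.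

Record coring_mor (A B : pzRingType) (beta : {rmorphism A -> B})
    (C : coring A) (D : coring B) (theta : C -> D) : Prop := {
  crm_bilin : bilin (theta : C -> lrestr beta (rrestr beta D));
  crm_Delta : forall c,
    chi (tmap (M' := lrestr beta (rrestr beta D))
              (N' := lrestr beta (rrestr beta D)) theta theta (Delta c))
      = Delta (theta c);
  crm_eps : forall c, eps (theta c) = beta (eps c) }.

Record pairing_mor (A B : pzRingType) (beta : {rmorphism A -> B})
    (P : pairing A) (Q : pairing B) := PairingMor {
  theta : pr_C P -> pr_C Q;
  xi : restr_aring beta (pr_T Q) -> pr_T P;
  thetaP : coring_mor beta theta;
  xiP : aring_mor xi;
  theta_xi : forall (s : pr_T Q) (c : pr_C P), pr s (theta c) = beta (pr (xi s) c) }.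

Record comodule (A : pzRingType) (C : coring A) := Comodule {
  cm :> rmod A;
  rho : cm -> tens cm C;
  rhoP : rlinear (rho : cm -> tens_r cm C);
  rho_coassoc : forall m, tassoc (tmap (M' := tens_r cm C) rho id (rho m))
    = tmap id (@Delta A C) (rho m);
  rho_counit : forall m, ev (@eps A C) (rho m) = m }.

Record colin (A : pzRingType) (C : coring A) (M N : comodule C) := Colin {
  cl_fun :> M -> N;
  cl_lin : rlinear cl_fun;
  cl_rho : forall m, tmap cl_fun id (rho m) = rho (cl_fun m) }.

Lemma tmap_id A (M : rmod A) (N : lmodType A) (z : tens M N) : tmap id id z = z.
Proof.
elim/tens_ind: z => [m n|x y hx hy]; first exact: tmapE.
by rewrite tmapD // hx hy.
Qed.

Lemma tmap_comp A (M M' M'' : rmod A) (N N' N'' : lmodType A)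
    (f : M -> M') (f' : M' -> M'') (g : N -> N') (g' : N' -> N'') :
  rlinear f -> rlinear f' -> llinear g -> llinear g' ->
  forall z, tmap f' g' (tmap f g z) = tmap (f' \o f) (g' \o g) z.
Proof.
move=> hf hf' hg hg'; have hff := rlin_comp hf' hf; have hgg := llin_comp hg' hg.
elim/tens_ind => [m n|x y hx hy]; first by rewrite !tmapE.
by rewrite !tmapD // hx hy.
Qed.

Section Category.
Variables (A : pzRingType) (C : coring A).
Definition colin_id (M : comodule C) : colin M M :=
  Colin (@rlin_id A M) (fun m => tmap_id (rho m)).
Section Comp.
Variables (M N L : comodule C) (g : colin N L) (f : colin M N).
Fact colin_comp_lin : rlinear (g \o f).
Proof. exact: rlin_comp (cl_lin g) (cl_lin f). Qed.
Fact colin_comp_rho m : tmap (g \o f) id (rho m) = rho ((g \o f) m).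
Proof.
by rewrite /= -cl_rho -cl_rho tmap_comp //; [exact: cl_lin | exact: cl_lin].
Qed.
Definition colin_comp : colin M L := Colin colin_comp_lin colin_comp_rho.
End Comp.
End Category.

Record cofunctor (A B : pzRingType) (D : coring B) (C : coring A) := Cofunctor {
  cf_ob :> comodule D -> comodule C;
  cf_mor : forall N N' : comodule D, colin N N' -> colin (cf_ob N) (cf_ob N');
  cf_id : forall (N : comodule D) x, cf_mor (colin_id N) x = x;
  cf_comp : forall (N N' N'' : comodule D) (g : colin N' N'') (f : colin N N') x,
    cf_mor (colin_comp g f) x = cf_mor g (cf_mor f x) }.

Definition nat_iso (A B : pzRingType) (D : coring B) (C : coring A)
    (F G : cofunctor D C) : Prop :=
  exists (phi : forall N, colin (F N) (G N)) (psi : forall N, colin (G N) (F N)),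
    [/\ forall N, cancel (phi N) (psi N), forall N, cancel (psi N) (phi N) &
        forall (N N' : comodule D) (f : colin N N') x,
          phi N' (cf_mor F f x) = cf_mor G f (phi N x)].

Lemma ev_rho A (C : coring A) (N : comodule C) (f g : ldual C) (n : N) :
  ev g (rho (ev f (rho n))) = ev (lstar f g) (rho n).
Proof.
rewrite -(@ev_ev A C N f g (lstar f g) _ _ (rho_coassoc n)) //.
congr (ev g _); apply/esym.
by apply: (ev_tmap (h := @rho A C N : N -> tens_r N C)) => //; exact: rhoP.
Qed.

Record submod (A : pzRingType) (M : rmod A) := Submod {
  sm_pred :> M -> Prop;
  sm0 : sm_pred 0;
  smD : forall x y, sm_pred x -> sm_pred y -> sm_pred (x + y);
  smZ : forall x a, sm_pred x -> sm_pred (x *< a) }.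

Definition sub_car (A : pzRingType) (M : rmod A) (K : submod M) : Type :=
  {x : M | K x}.

Section SubRmod.
Variables (A : pzRingType) (M : rmod A) (K : submod M).
Local Notation T := (sub_car K).
HB.instance Definition _ := gen_eqMixin T.
HB.instance Definition _ := gen_choiceMixin T.
Lemma sub_eq (x y : T) : sval x = sval y -> x = y.
Proof.
case: x y => x hx [y hy] /= e; subst y; congr exist; exact: Prop_irrelevance.
Qed.
Fact smN x : K x -> K (- x).
Proof. by move=> h; rewrite -ractN1; exact: smZ. Qed.
Let add (x y : T) : T := exist _ (sval x + sval y) (smD (svalP x) (svalP y)).
Let opp (x : T) : T := exist _ (- sval x) (smN (svalP x)).
Let zero : T := exist _ 0 (sm0 K).
Fact sub_addA : associative add. Proof. by move=> *; apply: sub_eq; exact: addrA. Qed.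
Fact sub_addC : commutative add. Proof. by move=> *; apply: sub_eq; exact: addrC. Qed.
Fact sub_add0 : left_id zero add. Proof. by move=> *; apply: sub_eq; exact: add0r. Qed.
Fact sub_addN : left_inverse zero opp add.
Proof. by move=> *; apply: sub_eq; exact: addNr. Qed.
HB.instance Definition _ := GRing.isZmodule.Build T sub_addA sub_addC sub_add0 sub_addN.
Let act (x : T) (a : A) : T := exist _ (sval x *< a) (smZ a (svalP x)).
Fact sub_actDl (x y : T) a : act (x + y) a = act x a + act y a.
Proof. by apply: sub_eq; exact: ractDl. Qed.
Fact sub_actDr (x : T) a b : act x (a + b) = act x a + act x b.
Proof. by apply: sub_eq; exact: ractDr. Qed.
Fact sub_act1 (x : T) : act x 1 = x. Proof. by apply: sub_eq; exact: ract1. Qed.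
Fact sub_actA (x : T) a b : act (act x a) b = act x (a * b).
Proof. by apply: sub_eq; exact: ractA. Qed.
Definition sub_rmod : rmod A := Rmod sub_actDl sub_actDr sub_act1 sub_actA.
Canonical sub_rmod.
Lemma sval_rlin : rlinear (sval : sub_rmod -> M). Proof. by []. Qed.
End SubRmod.

Section Quotient.
Variables (V : zmodType) (K : V -> Prop).
Hypotheses (K0 : K 0) (KD : forall x y, K x -> K y -> K (x + y))
  (KN : forall x, K x -> K (- x)).
Let rel (x y : V) : bool := `[< K (x - y) >].
Fact quot_refl : reflexive rel. Proof. by move=> x; apply/asboolP; rewrite subrr. Qed.
Fact quot_sym : symmetric rel.
Proof. by move=> x y; apply/asboolP/asboolP => /KN; rewrite opprB. Qed.
Fact quot_trans : transitive rel.
Proof.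
move=> y x z /asboolP h /asboolP /(KD h) h'; apply/asboolP.
by rewrite addrA subrK in h'.
Qed.
Definition quot_equiv := EquivRel rel quot_refl quot_sym quot_trans.
Definition quot : Type := {eq_quot quot_equiv}.
HB.instance Definition _ := Choice.on quot.
HB.instance Definition _ := EqQuotient.on quot.
Definition qpi (x : V) : quot := \pi_quot x.
Definition qrepr (x : quot) : V := repr x.
Fact qreprK x : qpi (qrepr x) = x. Proof. exact: reprK. Qed.
Fact qpiP x y : K (x - y) <-> qpi x = qpi y.
Proof. by rewrite /qpi; split=> [h|/eqmodP/asboolP//]; apply/eqmodP/asboolP. Qed.
Fact qreprP x : K (qrepr (qpi x) - x). Proof. by apply/qpiP; rewrite qreprK. Qed.
Let add x y := qpi (qrepr x + qrepr y).
Let opp x := qpi (- qrepr x).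
Fact qaddE x y : add (qpi x) (qpi y) = qpi (x + y).
Proof. by apply/qpiP; rewrite opprD addrACA; apply: KD; exact: qreprP. Qed.
Fact qoppE x : opp (qpi x) = qpi (- x).
Proof. by apply/qpiP; rewrite -opprD; apply: KN; exact: qreprP. Qed.
Fact quot_addA : associative add.
Proof.
by move=> x y z; rewrite -(qreprK x) -(qreprK y) -(qreprK z) !qaddE addrA.
Qed.
Fact quot_addC : commutative add.
Proof. by move=> x y; rewrite -(qreprK x) -(qreprK y) !qaddE addrC. Qed.
Fact quot_add0 : left_id (qpi 0) add.
Proof. by move=> x; rewrite -(qreprK x) qaddE add0r. Qed.
Fact quot_addN : left_inverse (qpi 0) opp add.
Proof. by move=> x; rewrite -(qreprK x) qoppE qaddE addNr. Qed.
HB.instance Definition _ := GRing.isZmodule.Build quot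
  quot_addA quot_addC quot_add0 quot_addN.
Lemma qpiD x y : qpi (x + y) = qpi x + qpi y. Proof. exact: esym (qaddE x y). Qed.
Lemma qpi0 x : qpi x = 0 <-> K x.
Proof. by rewrite -[0]/(qpi 0) -qpiP subr0. Qed.
End Quotient.

Section QuotRmod.
Variables (A : pzRingType) (M : rmod A) (K : submod M).
Let Q : zmodType := quot (sm0 K) (@smD _ _ K) (@smN _ _ K).
Local Notation p := (@qpi M K (sm0 K) (@smD _ _ K) (@smN _ _ K)).
Let act (x : Q) (a : A) : Q := p (qrepr x *< a).
Fact quot_actE x a : act (p x) a = p (x *< a).
Proof. by apply/qpiP; rewrite -ractNl -ractDl; apply: smZ; exact: qreprP. Qed.
Fact quot_actDl (x y : Q) a : act (x + y) a = act x a + act y a.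
Proof. by rewrite -(qreprK x) -(qreprK y) -qpiD !quot_actE ractDl qpiD. Qed.
Fact quot_actDr (x : Q) a b : act x (a + b) = act x a + act x b.
Proof. by rewrite -(qreprK x) !quot_actE ractDr qpiD. Qed.
Fact quot_act1 (x : Q) : act x 1 = x.
Proof. by rewrite -(qreprK x) quot_actE ract1. Qed.
Fact quot_actA (x : Q) a b : act (act x a) b = act x (a * b).
Proof. by rewrite -(qreprK x) !quot_actE ractA. Qed.
Definition quot_rmod : rmod A := Rmod quot_actDl quot_actDr quot_act1 quot_actA.
Definition quot_pi : M -> quot_rmod := p.
Lemma quot_pi_lin : rlinear quot_pi.
Proof. by split=> x y; [exact: qpiD | exact: esym (quot_actE x y)]. Qed.
Lemma quot_pi0 x : quot_pi x = 0 <-> K x. Proof. exact: qpi0. Qed.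
Lemma quot_pi_surj x : exists y, quot_pi y = x.
Proof. by exists (qrepr x); exact: qreprK. Qed.
End QuotRmod.

Record rhom (A : pzRingType) (M N : rmod A) := Rhom {
  rh_fun :> M -> N;
  rhP : rlinear rh_fun }.

Section RhomZmod.
Variables (A : pzRingType) (M N : rmod A).
Local Notation T := (rhom M N).
HB.instance Definition _ := gen_eqMixin T.
HB.instance Definition _ := gen_choiceMixin T.
Lemma rhom_eq (f g : T) : f =1 g -> f = g.
Proof.
case: f g => f hf [g hg] /= /funext e; subst g.
by congr Rhom; exact: Prop_irrelevance.
Qed.
Lemma rhD (f : T) x y : f (x + y) = f x + f y. Proof. by case: (rhP f). Qed.
Lemma rhZ (f : T) x a : f (x *< a) = f x *< a. Proof. by case: (rhP f). Qed.
Fact rhom_addP (f g : T) : rlinear (fun x => f x + g x).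
Proof. by split=> x y; [rewrite !rhD addrACA | rewrite !rhZ ractDl]. Qed.
Fact rhom_oppP (f : T) : rlinear (fun x => - f x).
Proof. by split=> x y; [rewrite rhD opprD | rewrite rhZ ractNl]. Qed.
Fact rhom_zeroP : rlinear (fun _ : M => 0 : N).
Proof. by split=> x y; [rewrite addr0 | rewrite ract0l]. Qed.
Let add f g := Rhom (rhom_addP f g).
Let opp f := Rhom (rhom_oppP f).
Let zero := Rhom rhom_zeroP.
Fact rhom_addA : associative add.
Proof. by move=> *; apply: rhom_eq => x; exact: addrA. Qed.
Fact rhom_addC : commutative add.
Proof. by move=> *; apply: rhom_eq => x; exact: addrC. Qed.
Fact rhom_add0 : left_id zero add.
Proof. by move=> *; apply: rhom_eq => x; exact: add0r. Qed.
Fact rhom_addN : left_inverse zero opp add.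
Proof. by move=> *; apply: rhom_eq => x; exact: addNr. Qed.
HB.instance Definition _ := GRing.isZmodule.Build T
  rhom_addA rhom_addC rhom_add0 rhom_addN.
End RhomZmod.

Section Exactness.
Variables (A : pzRingType) (P : pairing A).
Hypothesis hP : alpha_pairing P.
Local Notation C := (pr_C P).

Lemma ev_inj (M : rmod A) (z z' : tens M C) :
  (forall t : pr_T P, ev (pr t) z = ev (pr t) z') -> z = z'.
Proof. by move=> h; apply: hP; exact: funext. Qed.

Variables (K M : rmod A) (iota : K -> M).
Hypotheses (iota_lin : rlinear iota) (iota_inj : injective iota).
Let tiota : tens K C -> tens M C := tmap iota id.
Let tiotaD x y : tiota (x + y) = tiota x + tiota y.
Proof. exact: (tmapD iota_lin (@llin_id _ _)). Qed.

Lemma tmap_inj : injective tiota.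
Proof.
move=> z z' e; apply: ev_inj => t; apply: iota_inj.
by rewrite -!(ev_tmap (k := id) (f := pr t) _ iota_lin (@llin_id _ _)) //; congr ev.
Qed.

Lemma tens_lift_sub (z : tens M C) :
  (forall t : pr_T P, exists x, iota x = ev (pr t) z) ->
  exists w : tens K C, tmap iota id w = z.
Proof.
move=> hz.
have [iD iZ] := iota_lin.
have im0 : exists x, iota x = 0 by exists 0; exact: morph0.
have imD m m' : (exists x, iota x = m) -> (exists x, iota x = m') ->
    exists x, iota x = m + m' by move=> [x <-] [y <-]; exists (x + y).
have imZ m a : (exists x, iota x = m) -> exists x, iota x = m *< a.
  by move=> [x <-]; exists (x *< a).
pose im : submod M := Submod im0 imD imZ.
pose im2 (z : tens M C) := exists w, tiota w = z.
have im20 : im2 0 by exists 0; exact: morph0.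
have im2D x y : im2 x -> im2 y -> im2 (x + y).
  by move=> [u <-] [v <-]; exists (u + v).
have im2N x : im2 x -> im2 (- x) by move=> [u <-]; exists (- u); exact: morphN.
pose q := @qpi _ im2 im20 im2D im2N.
have qD x y : q (x + y) = q x + q y by exact: qpiD.
pose sec (x : quot_rmod im) : M := projT1 (cid (quot_pi_surj x)).
have secK x : quot_pi im (sec x) = x by rewrite /sec; case: cid.
have qE (m m' : M) c : quot_pi im m = quot_pi im m' -> q (m ⊗ c) = q (m' ⊗ c).
  move=> e; apply/qpiP.
  have /quot_pi0 [x ex] : quot_pi im (m - m') = 0.
    have [pD _] := quot_pi_lin im.
    by rewrite pD (morphN pD) e subrr.
  exists (x ⊗ c); rewrite /tiota tmapE // ex.
  have eD : forall u v : M, (u + v) ⊗ c = u ⊗ c + v ⊗ c by move=> *; exact: tpureDl.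
  by rewrite eD (morphN eD).
have [pD pZ] := quot_pi_lin im.
pose h (x : quot_rmod im) c := q (sec x ⊗ c).
have hb : balanced h.
  split=> [x y c|x c d|x a c]; rewrite /h.
  - rewrite -qD -tpureDl; apply: qE.
    by rewrite pD !secK.
  - by rewrite -qD tpureDr.
  - by rewrite -tpureA; apply: qE; rewrite pZ !secK.
have e : forall v : tens M C, tlift h (tmap (quot_pi im) id v) = q v.
  apply: tens_ext => [x y|x y|m c].
  - by rewrite tmapD // (tliftD hb).
  - exact: qD.
  - by rewrite tmapE // (tlift_pure hb); apply: qE; rewrite secK.
have /qpi0 // : q z = 0.
rewrite -e (_ : tmap _ _ z = 0); first exact: (morph0 (tliftD hb)).
apply: ev_inj => t; rewrite (morph0 (evD (pr t))).
rewrite (ev_tmap (g := pr t) _ (quot_pi_lin im)) //.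
by apply/quot_pi0; exact: hz.
Qed.
End Exactness.

(* If K embeds into M, with a right A-linear map r : K -> M ⊗_A C such that
   K is a right T-module satisfying iota(x t) = \sum m_i <t, c_i> for
   r x = \sum m_i ⊗ c_i, then r factors uniquely through K ⊗_A C and makes
   K a right C-comodule. *)
Section LiftComodule.
Variables (A : pzRingType) (P : pairing A).
Hypothesis hP : alpha_pairing P.
Local Notation C := (pr_C P).
Local Notation T := (pr_T P).
Variables (K M : rmod A) (iota : K -> M) (r : K -> tens_r M C) (act : K -> T -> K).
Hypotheses (iota_lin : rlinear iota) (iota_inj : injective iota)
  (r_lin : rlinear r)
  (act_r : forall x t, iota (act x t) = ev (pr t) (r x))
  (act1 : forall x, act x (ar_unit T 1) = x)
  (actM : forall x t u, act x (ar_mul t u) = act (act x t) u).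

Fact lift_rho_ex x : exists w : tens K C, tmap iota id w = r x.
Proof. by apply: tens_lift_sub => // t; exists (act x t). Qed.
Definition lift_rho (x : K) : tens K C := projT1 (cid (lift_rho_ex x)).
Lemma lift_rhoE x : tmap iota id (lift_rho x) = r x.
Proof. by rewrite /lift_rho; case: cid. Qed.
Lemma ev_lift_rho x t : ev (pr t) (lift_rho x) = act x t.
Proof.
by apply: iota_inj; rewrite act_r -lift_rhoE (ev_tmap (g := pr t)).
Qed.
Fact lift_rho_lin : rlinear (lift_rho : K -> tens_r K C).
Proof.
have [iD iZ] := iota_lin; have [rD rZ] := r_lin.
split=> [x y|x a]; apply: (tmap_inj hP iota_lin iota_inj).
  by rewrite tmapD // !lift_rhoE rD.
rewrite lift_rhoE rZ -lift_rhoE.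
elim/tens_ind: (lift_rho x) => [k c|u v hu hv].
  by rewrite !tens_actE !tmapE // tens_actE.
by rewrite ractDl !tmapD // ractDl hu hv.
Qed.
Lemma pr_mul (t u : T) : lstar (pr t) (pr u) =1 pr (ar_mul t u).
Proof. by move=> c; rewrite /pr (arm_mul (kappaP P)). Qed.
Lemma pr_unit : pr (ar_unit T 1) =1 @eps A C.
Proof. by move=> c; rewrite /pr (arm_unit (kappaP P)) /= mulr1. Qed.
Fact lift_coassoc x : tassoc (tmap (M' := tens_r K C) lift_rho id (lift_rho x))
    = tmap id (@Delta A C) (lift_rho x).
Proof.
rewrite -[RHS]tassocVK; congr tassoc.
apply: (ev_inj hP) => t; apply: (ev_inj hP) => u.
rewrite (ev_tmap (g := pr t) _ lift_rho_lin) // !ev_lift_rho.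
rewrite (ev_ev (fg := pr (ar_mul t u)) (tassocVK _)); last exact: pr_mul.
by rewrite ev_lift_rho actM.
Qed.
Fact lift_counit x : ev (@eps A C) (lift_rho x) = x.
Proof.
rewrite -[RHS]act1 -ev_lift_rho; congr (ev _ _).
by apply: funext => c; rewrite pr_unit.
Qed.
Definition lift_comodule : comodule C :=
  Comodule lift_rho_lin lift_coassoc lift_counit.
End LiftComodule.

Section LiftColin.
Variables (A : pzRingType) (P : pairing A).
Hypothesis hP : alpha_pairing P.
Variables (N N' : comodule (pr_C P)) (f : N -> N').
Hypotheses (f_lin : rlinear f)
  (f_act : forall t x, f (ev (pr t) (rho x)) = ev (pr t) (rho (f x))).
Fact lift_cl_rho x : tmap f id (rho x) = rho (f x).
Proof.
by apply: (ev_inj hP) => t; rewrite -f_act; exact: (ev_tmap (g := pr t)).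
Qed.
Definition lift_colin : colin N N' := Colin f_lin lift_cl_rho.
End LiftColin.

Section Rational.
Variables (A : pzRingType) (P : pairing A).
Hypothesis hP : alpha_pairing P.
Local Notation C := (pr_C P).
Local Notation T := (pr_T P).

Section Rat.
Variable M : rmod (ring_of T).
Definition rational (m : M) : Prop :=
  exists z : tens (rres M) C, forall t : T, m *< (t : ring_of T) = ev (pr t) z.

Fact rational0 : rational 0.
Proof. by exists 0 => t; rewrite ract0l (morph0 (evD (pr t))). Qed.
Fact rationalD x y : rational x -> rational y -> rational (x + y).
Proof.
by move=> [z hz] [w hw]; exists (z + w) => t; rewrite ractDl hz hw evD.
Qed.
Lemma prZ a (t : T) c : pr t (c *< a) = pr (a *: t) c.
Proof. by rewrite /pr (proj2 (proj1 (arm_bilin (kappaP P)))). Qed.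
Fact rational_res (x : M) a (z : tens (rres M) C) :
  (forall t : T, x *< (t : ring_of T) = ev (pr t) z) ->
  forall t : T, (x *< (ar_unit T a : ring_of T)) *< (t : ring_of T)
    = ev (pr t) (z *< a : tens_r (rres M) C).
Proof.
move=> hz t; rewrite ractA (ev_ract (g := pr (a *: t))); last exact: prZ.
by rewrite -hz; congr (_ *< _); exact: ar_mul_unitl.
Qed.
Fact rationalZ (x : rres M) a : rational x -> rational (x *< a).
Proof. by move=> [z hz]; exists (z *< a); exact: rational_res. Qed.
Definition Rat : submod (rres M) :=
  @Submod A (rres M) rational rational0 rationalD rationalZ.
Definition rat_r (x : sub_rmod Rat) : tens_r (rres M) C := projT1 (cid (svalP x)).
Lemma rat_rE (x : sub_rmod Rat) (t : T) :
  (sval x : M) *< (t : ring_of T) = ev (pr t) (rat_r x).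
Proof. by rewrite /rat_r; case: cid. Qed.
Fact rat_r_lin : rlinear rat_r.
Proof.
split=> [x y|x a]; apply: (ev_inj hP) => t.
  by rewrite evD -!rat_rE; exact: (@ractDl _ M (sval x) (sval y)).
by rewrite -rat_rE; apply: rational_res => u; exact: rat_rE.
Qed.
Fact rational_act (x : M) (t : T) : rational x -> rational (x *< (t : ring_of T)).
Proof.
move=> [z hz]; pose d := (tassocV (tmap id (@Delta A C) z)).
exists (ev (pr t) d) => u; rewrite ractA (hz (ar_mul t u)).
by rewrite (ev_ev (fg := pr (ar_mul t u)) (tassocVK _)) //; exact: pr_mul.
Qed.
Definition rat_act (x : sub_rmod Rat) (t : T) : sub_rmod Rat :=
  exist _ ((sval x : M) *< (t : ring_of T)) (rational_act t (svalP x)).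
Fact rat_act1 x : rat_act x (ar_unit T 1) = x.
Proof. by apply: sub_eq; exact: ract1. Qed.
Fact rat_actM x t u : rat_act x (ar_mul t u) = rat_act (rat_act x t) u.
Proof. by apply: sub_eq; rewrite /= ractA. Qed.
Fact rat_iota_inj : injective (sval : sub_rmod Rat -> rres M).
Proof. by move=> x y /sub_eq. Qed.

(* Rat^C(M), with the coaction m |-> \sum m_i ⊗ c_i, where
   m t = \sum m_i <t, c_i> for all t. *)
Definition Rat_comodule : comodule C :=
  lift_comodule (act := rat_act) hP (@sval_rlin _ _ Rat) rat_iota_inj rat_r_lin rat_rE
    rat_act1 rat_actM.
End Rat.

Section RatMor.
Variables (M M' : rmod (ring_of T)) (f : M -> M').
Hypothesis hf : rlinear f.
Fact rat_mor_res : rlinear (f : rres M -> rres M').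
Proof. by case: hf => fD fZ; split=> // x a; exact: fZ. Qed.
Fact rat_mor_rational x : rational x -> rational (f x).
Proof.
move=> [z hz]; exists (tmap (f : rres M -> rres M') id z) => t.
by rewrite -(proj2 hf) hz (ev_tmap (g := pr t) _ rat_mor_res).
Qed.
Definition rat_mor (x : Rat_comodule M) : Rat_comodule M' :=
  exist _ (f (sval x)) (rat_mor_rational (svalP x)).
Fact rat_mor_lin : rlinear rat_mor.
Proof.
by case: hf => fD fZ; split=> x y; apply: sub_eq; [exact: fD | exact: fZ].
Qed.
Fact rat_mor_act t x :
  rat_mor (ev (pr t) (rho x)) = ev (pr t) (rho (rat_mor x)).
Proof.
by rewrite !ev_lift_rho; apply: sub_eq; exact: (proj2 hf).
Qed.
Definition Rat_colin : colin (Rat_comodule M) (Rat_comodule M') :=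
  lift_colin hP rat_mor_lin rat_mor_act.
End RatMor.
End Rational.

Lemma tassocK (A B : pzRingType) (M : rmod A) (Y : bimod A B) (N : lmodType B)
    (z : tens (tens_r M Y) N) : tassocV (tassoc z) = z.
Proof.
by elim/tens3l_ind: z => [m y n|x y hx hy];
  rewrite ?tassocE ?tassocVE // tassocD tassocVD hx hy.
Qed.

Lemma ev_tassocV (A B : pzRingType) (M : rmod B) (Y : bimod B A) (C : lmodType A)
    (f : ldual C) (m : M) (v : tens Y C) :
  ev f (tassocV (m ⊗ v)) = m ⊗ (ev f v : Y).
Proof.
elim/tens_ind: v => [y c|x y hx hy].
  by rewrite tassocVE !evE; exact: tens_actE.
by rewrite tpureDr tassocVD !evD tpureDr hx hy.
Qed.

Lemma ev_llinear (A B : pzRingType) (Y : bimod B A) (C : lmodType A)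
    (f : ldual C) : llinear (fun z : tens Y C => ev f z : Y).
Proof.
split=> [|a z]; first exact: evD.
elim/tens_ind: z => [c d|x y hx hy]; last by rewrite scalerDr !evD hx hy scalerDr.
by rewrite tens_scaleE !evE; exact: bactZ.
Qed.

Lemma tmap_rlin (A B : pzRingType) (M M' : rmod A) (Y Y' : bimod A B)
    (f : M -> M') (g : Y -> Y') :
  rlinear f -> bilin g -> rlinear (tmap f g : tens_r M Y -> tens_r M' Y').
Proof.
move=> hf [hg gR]; split=> [x y|z b]; first exact: tmapD.
elim/tens_ind: z => [m y|x y hx hy]; last by rewrite ractDl !tmapD // ractDl hx hy.
by rewrite tens_actE !tmapE // tens_actE; congr (_ ⊗ _); exact: (proj2 gR).
Qed.

Lemma tmap_llin (A B : pzRingType) (X X' : bimod B A) (N N' : lmodType A)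
    (f : X -> X') (g : N -> N') :
  bilin f -> llinear g -> llinear (tmap f g : tens X N -> tens X' N').
Proof.
move=> [fL fR] hg; split=> [x y|b z]; first exact: tmapD.
elim/tens_ind: z => [m y|x y hx hy].
  by rewrite tens_scaleE !tmapE // tens_scaleE; congr (_ ⊗ _); exact: (proj2 fL).
by rewrite scalerDr !tmapD // scalerDr hx hy.
Qed.

Lemma tassocV_rlin (A B D : pzRingType) (M : rmod A) (Y : bimod A B) (N : bimod B D) :
  rlinear (@tassocV A B M Y N : tens_r M (tens_b Y N) -> tens_r (tens_r M Y) N).
Proof.
split=> [x y|z d]; first exact: tassocVD.
elim/tens3_ind: z => [m y n|x y hx hy]; last by rewrite ractDl !tassocVD ractDl hx hy.
by rewrite tens_actE (tens_actE y) !tassocVE tens_actE.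
Qed.

Lemma tassocV_llin (A B D : pzRingType) (M : bimod D A) (Y : bimod A B) (N : lmodType B) :
  llinear (@tassocV A B M Y N : tens M (tens Y N) -> tens (tens_b M Y) N).
Proof.
split=> [x y|d z]; first exact: tassocVD.
elim/tens3_ind: z => [m y n|x y hx hy]; last by rewrite scalerDr !tassocVD scalerDr hx hy.
by rewrite tens_scaleE !tassocVE tens_scaleE (tens_scaleE (N := Y)).
Qed.

Section Fmod.
Variables (A : pzRingType) (I : Type) (M : rmod A).
Definition fmod : Type := I -> M.
HB.instance Definition _ := gen_eqMixin fmod.
HB.instance Definition _ := gen_choiceMixin fmod.
Fact fmod_addA : associative (fun (f g : fmod) i => f i + g i).
Proof. by move=> f g h; apply: funext => i; exact: addrA. Qed.
Fact fmod_addC : commutative (fun (f g : fmod) i => f i + g i).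
Proof. by move=> f g; apply: funext => i; exact: addrC. Qed.
Fact fmod_add0 : left_id (fun=> 0) (fun (f g : fmod) i => f i + g i).
Proof. by move=> f; apply: funext => i; exact: add0r. Qed.
Fact fmod_addN : left_inverse (fun=> 0) (fun (f : fmod) i => - f i)
  (fun (f g : fmod) i => f i + g i).
Proof. by move=> f; apply: funext => i; exact: addNr. Qed.
HB.instance Definition _ := GRing.isZmodule.Build fmod
  fmod_addA fmod_addC fmod_add0 fmod_addN.
Let act (f : fmod) (a : A) : fmod := fun i => f i *< a.
Fact fmod_actDl (f g : fmod) a : act (f + g) a = act f a + act g a.
Proof. by apply: funext => i; exact: ractDl. Qed.
Fact fmod_actDr (f : fmod) a b : act f (a + b) = act f a + act f b.
Proof. by apply: funext => i; exact: ractDr. Qed.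
Fact fmod_act1 (f : fmod) : act f 1 = f.
Proof. by apply: funext => i; exact: ract1. Qed.
Fact fmod_actA (f : fmod) a b : act (act f a) b = act f (a * b).
Proof. by apply: funext => i; exact: ractA. Qed.
Definition fmod_rmod : rmod A := Rmod fmod_actDl fmod_actDr fmod_act1 fmod_actA.
End Fmod.

Section ComodRmod.
Variables (B : pzRingType) (Q : pairing B) (N : comodule (pr_C Q)).
Local Notation S := (pr_T Q).
Let act (n : N) (s : ring_of S) : N := ev (pr (s : S)) (rho n).
Fact comod_actDl x y s : act (x + y) s = act x s + act y s.
Proof. by rewrite /act (proj1 (rhoP N)) evD. Qed.
Fact comod_actDr x s t : act x (s + t) = act x s + act x t.
Proof.
rewrite /act -ev_addf; congr ev; apply: funext => c.
by rewrite /pr (proj1 (proj1 (arm_bilin (kappaP Q)))).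
Qed.
Fact comod_act1 x : act x 1 = x.
Proof.
by rewrite /act -[RHS]rho_counit; congr (ev _ _); apply: funext; exact: pr_unit.
Qed.
Fact comod_actA x s t : act (act x s) t = act x (s * t).
Proof.
by rewrite /act ev_rho; congr (ev _ _); apply: funext => c; exact: pr_mul.
Qed.
(* n s = \sum n_0 <s, n_1> *)
Definition comod_rmod : rmod (ring_of S) :=
  Rmod comod_actDl comod_actDr comod_act1 comod_actA.
End ComodRmod.

Lemma colin_act (B : pzRingType) (Q : pairing B) (N N' : comodule (pr_C Q))
    (f : colin N N') : rlinear (f : comod_rmod N -> comod_rmod N').
Proof.
have [fD fZ] := cl_lin f; split=> // n s /=.
by rewrite /ract /= -cl_rho; apply/esym/ev_tmap => //; exact: cl_lin.
Qed.

Section Functors.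
Variables (A B : pzRingType) (beta : {rmorphism A -> B}).
Variables (P : pairing A) (Q : pairing B) (f : pairing_mor beta P Q).
Hypothesis hP : alpha_pairing P.
Local Notation C := (pr_C P).
Local Notation T := (pr_T P).
Local Notation D := (pr_C Q).
Local Notation S := (pr_T Q).
Local Notation M_D := (comodule D).

Definition TB : zmodType := tens T (lrestr beta (reg B)).

(* The right S-module structure (t ⊗ b) s = t xi(s) ⊗ b on T ⊗_A B.  The
   formula need not define a map on T ⊗_A B for arbitrary pairings, so that
   the structure is a datum; it is unique and the remaining module axioms
   follow from the formula. *)
Record TB_structure := TBStructure {
  tb_act : TB -> S -> TB;
  tb_actD : forall x y s, tb_act (x + y) s = tb_act x s + tb_act y s;
  tb_actE : forall (t : T) (b : B) (s : S),
    tb_act (tpure (M := T) (N := lrestr beta (reg B)) t b) s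
      = tpure (M := T) (N := lrestr beta (reg B)) (ar_mul t (xi f s)) b }.

Section Coinduction.
Variable TBs : TB_structure.
Let act (x : TB) (s : ring_of S) : TB := tb_act TBs x s.
Fact TB_actDl x y s : act (x + y) s = act x s + act y s.
Proof. exact: tb_actD. Qed.
Fact TB_actDr x s s' : act x (s + s') = act x s + act x s'.
Proof.
have [_ mD _] := ar_mul_bal T.
have [[xD _] _] := arm_bilin (xiP f).
rewrite /act; elim/tens_ind: x => [t b|x y hx hy].
  by rewrite !tb_actE xD ring_of_mulDr tpureDl.
by rewrite !tb_actD hx hy addrACA.
Qed.
Fact TB_act1 x : act x 1 = x.
Proof.
rewrite /act; elim/tens_ind: x => [t b|x y hx hy]; last by rewrite tb_actD hx hy.
rewrite tb_actE; congr (_ ⊗ _).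
have := arm_unit (xiP f) 1; rewrite /= rmorph1 => h.
by rewrite [xi f _]h ar_mul1r.
Qed.
Fact TB_actA x s s' : act (act x s) s' = act x (s * s').
Proof.
rewrite /act; elim/tens_ind: x => [t b|x y hx hy]; last by rewrite !tb_actD hx hy.
by rewrite !tb_actE -ar_mulA -(arm_mul (xiP f)).
Qed.
Definition TB_rmod : rmod (ring_of S) :=
  Rmod TB_actDl TB_actDr TB_act1 TB_actA.

Fact mul_rlin (t : T) : rlinear (ar_mul t : T -> T).
Proof. by split=> u v; [exact: ring_of_mulDr | exact: ar_mulR]. Qed.
Definition TB_lmul (t : T) (x : TB_rmod) : TB_rmod := tmap (ar_mul t : T -> T) id x.
Lemma TB_lmulD t x y : TB_lmul t (x + y) = TB_lmul t x + TB_lmul t y.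
Proof. exact: tmapD (mul_rlin t) (@llin_id _ _) _ _. Qed.
Lemma TB_lmulE t (u : T) (b : lrestr beta (reg B)) :
  TB_lmul t (u ⊗ b) = ar_mul t u ⊗ b.
Proof. exact: tmapE (mul_rlin t) (@llin_id _ _) _ _. Qed.
Fact TB_lmul_rlin t : rlinear (TB_lmul t).
Proof.
split=> [x y|x s]; first exact: TB_lmulD.
elim/tens_ind: x => [u b|x y hx hy]; last by rewrite ractDl !TB_lmulD ractDl hx hy.
by rewrite /ract /= /act TB_lmulE !tb_actE TB_lmulE ar_mulA.
Qed.

Section CoindObj.
Variable N : M_D.
Local Notation H := (rhom TB_rmod (comod_rmod N)).
Let actH (phi : H) (t : ring_of T) : H := Rhom (rlin_comp (rhP phi) (TB_lmul_rlin t)).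
Fact H_actDl phi psi t : actH (phi + psi) t = actH phi t + actH psi t.
Proof. exact: rhom_eq. Qed.
Fact H_actDr phi t u : actH phi (t + u) = actH phi t + actH phi u.
Proof.
apply: rhom_eq => x; transitivity (phi (TB_lmul t x + TB_lmul u x)); last exact: rhD.
congr (rh_fun phi _); elim/tens_ind: x => [v b|x y hx hy].
  by rewrite !TB_lmulE ring_of_mulDl tpureDl.
by rewrite !TB_lmulD hx hy addrACA.
Qed.
Fact H_act1 phi : actH phi 1 = phi.
Proof.
apply: rhom_eq => x /=; congr (rh_fun phi _).
elim/tens_ind: x => [v b|x y hx hy]; last by rewrite !TB_lmulD hx hy.
by rewrite !TB_lmulE ar_mul1l.
Qed.
Fact H_actA phi t u : actH (actH phi t) u = actH phi (t * u).
Proof.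
apply: rhom_eq => x /=; congr (rh_fun phi _).
elim/tens_ind: x => [v b|x y hx hy]; last by rewrite !TB_lmulD hx hy.
by rewrite !TB_lmulE ar_mulA.
Qed.
(* Hom_{-S}(T ⊗_A B, N), with (phi t')(t ⊗ b) = phi (t' t ⊗ b). *)
Definition Hom_TB : rmod (ring_of T) := Rmod H_actDl H_actDr H_act1 H_actA.
End CoindObj.

Section CoindMor.
Variables (N N' : M_D) (g : colin N N').
Definition Hom_TB_mor (phi : Hom_TB N) : Hom_TB N' :=
  Rhom (rlin_comp (colin_act g) (rhP phi)).
Fact Hom_TB_mor_lin : rlinear Hom_TB_mor.
Proof.
have [gD _] := cl_lin g.
by split=> x y; apply: rhom_eq => z //=; rewrite gD.
Qed.
End CoindMor.

Definition Coind_ob (N : M_D) : comodule C := Rat_comodule hP (Hom_TB N).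
Definition Coind_mor (N N' : M_D) (g : colin N N') : colin (Coind_ob N) (Coind_ob N') :=
  Rat_colin hP (Hom_TB_mor_lin g).
Fact Coind_id (N : M_D) x : Coind_mor (colin_id N) x = x.
Proof. by apply: sub_eq; exact: rhom_eq. Qed.
Fact Coind_comp (N N' N'' : M_D) (g : colin N' N'') (h : colin N N') x :
  Coind_mor (colin_comp g h) x = Coind_mor g (Coind_mor h x).
Proof. by apply: sub_eq; exact: rhom_eq. Qed.
Definition Coind : cofunctor D C := Cofunctor Coind_id Coind_comp.
End Coinduction.

Local Notation B_A := (rrestr beta (reg B)).
Definition BC : bimod B A := tens_b B_A C.

(* c |-> \sum theta(c_1) ⊗_B (1 ⊗_A c_2), then
   b ⊗ c |-> \sum b theta(c_1) ⊗_B (1 ⊗_A c_2); the target corresponds to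
   \sum b theta(c_1) ⊗_A c_2 under D ⊗_B (B ⊗_A C) = D ⊗_A C. *)
Definition theta2 (w : tens C C) : tens D BC :=
  tlift (fun c1 c2 : C => theta f c1 ⊗ (tpure (M := B_A) (1 : B) c2 : BC)) w.
Definition BC_lcoact : BC -> tens D BC :=
  tlift (M := B_A) (N := C) (fun (b : B) (c : C) => b *: theta2 (Delta c)).

(* b ⊗ c |-> \sum (b ⊗ c_1) ⊗ c_2 *)
Definition BC_rcoact (x : BC) : tens BC C :=
  tassocV (tmap (M := B_A) id (@Delta A C) x).

Lemma thetaD c c' : theta f (c + c') = theta f c + theta f c'.
Proof. by case: (crm_bilin (thetaP f)) => -[h _] _; exact: h. Qed.
Lemma thetaZ a c : theta f (a *: c) = beta a *: theta f c.
Proof. by case: (crm_bilin (thetaP f)) => -[_ h] _; exact: h. Qed.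
Lemma thetaR a c : theta f (c *< a) = theta f c *< beta a.
Proof. by case: (crm_bilin (thetaP f)) => _ [_ h]; exact: h. Qed.

Fact theta2_bal : balanced (fun c1 c2 : C =>
  theta f c1 ⊗ (tpure (M := B_A) (1 : B) c2 : BC)).
Proof.
split=> [c c' d|c d d'|c a d].
- by rewrite thetaD tpureDl.
- by rewrite tpureDr tpureDr.
- rewrite thetaR tpureA; congr (_ ⊗ _).
  rewrite [LHS](tens_scaleE (X := B_A)) -tpureA; congr (_ ⊗ _).
  by rewrite [LHS]mulr1 [RHS]mul1r.
Qed.
Lemma theta2D x y : theta2 (x + y) = theta2 x + theta2 y.
Proof. exact: tliftD theta2_bal _ _. Qed.
Lemma theta2E (c1 c2 : C) :
  theta2 (c1 ⊗ c2) = theta f c1 ⊗ (tpure (M := B_A) (1 : B) c2 : BC).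
Proof. exact: tlift_pure theta2_bal _ _. Qed.
Lemma theta2Z a w : theta2 (a *: w) = beta a *: theta2 w.
Proof.
elim/tens_ind: w => [c d|x y hx hy]; last by rewrite scalerDr !theta2D scalerDr hx hy.
by rewrite tens_scaleE !theta2E thetaZ tens_scaleE.
Qed.
Lemma theta2R (w : tens_r C C) a : theta2 (w *< a) = (theta2 w : tens_r D BC) *< a.
Proof.
elim/tens_ind: w => [c d|x y hx hy]; last by rewrite ractDl !theta2D ractDl hx hy.
by rewrite tens_actE !theta2E tens_actE; congr (_ ⊗ _); exact: esym (tens_actE _ _ _).
Qed.

Fact BC_lcoact_bal : balanced (M := B_A) (N := C)
  (fun (b : B) (c : C) => b *: theta2 (Delta c)).
Proof.
have [DD DZ] := Delta_l C.
split=> [b b' c|b c c'|b a c].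
- exact: scalerDl.
- by rewrite DD theta2D scalerDr.
- by rewrite DZ theta2Z scalerA.
Qed.
Lemma BC_lcoactE (b : B_A) (c : C) : BC_lcoact (b ⊗ c) = (b : B) *: theta2 (Delta c).
Proof. exact: tlift_pure BC_lcoact_bal _ _. Qed.
Lemma BC_lcoactD x y : BC_lcoact (x + y) = BC_lcoact x + BC_lcoact y.
Proof. exact: tliftD BC_lcoact_bal _ _. Qed.
Fact BC_lcoact_llin : llinear BC_lcoact.
Proof.
split=> [|b x]; first exact: BC_lcoactD.
elim/tens_ind: x => [b' c|x y hx hy]; last by rewrite scalerDr !BC_lcoactD scalerDr hx hy.
by rewrite [_ *: _](tens_scaleE (X := B_A)) !BC_lcoactE scalerA.
Qed.
Fact BC_lcoact_rlin : rlinear (BC_lcoact : BC -> tens_r D BC).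
Proof.
split=> [|x a]; first exact: BC_lcoactD.
elim/tens_ind: x => [b c|x y hx hy]; last by rewrite ractDl !BC_lcoactD ractDl hx hy.
rewrite [_ *< _](tens_actE (M := B_A)) !BC_lcoactE (proj2 (Delta_r C)) theta2R.
exact: esym (tens_actZ _ _ _).
Qed.
Fact BC_rcoact_llin : llinear BC_rcoact.
Proof.
apply: (llin_comp (g := tmap (M := B_A) id (@Delta A C)) (tassocV_llin B_A _ _)).
by apply: (tmap_llin (X := B_A) (X' := B_A)) => //; exact: Delta_l.
Qed.
Fact BC_rcoact_rlin : rlinear (BC_rcoact : BC -> tens_r BC C).
Proof.
apply: (rlin_comp (g := tmap (M := B_A) id (@Delta A C) : tens_r B_A C -> tens_r B_A (tens_b C C))
  (tassocV_rlin B_A _ _)).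
by apply: (tmap_rlin (Y' := tens_b C C)) => //; exact: Delta_bilin.
Qed.

(* n ⊗ x |-> \sum (n ⊗ x_0) ⊗ x_1 *)
Definition NBC_rcoact (N : M_D) (z : tens N BC) : tens (tens_r N BC) C :=
  tassocV (tmap id BC_rcoact z).
Fact NBC_rcoact_rlin (N : M_D) : rlinear (@NBC_rcoact N : tens_r N BC -> tens_r (tens_r N BC) C).
Proof.
apply: (rlin_comp (g := tmap id BC_rcoact : tens_r N BC -> tens_r N (tens_b BC C))
  (tassocV_rlin N _ _)).
apply: (tmap_rlin (Y' := tens_b BC C)) => //.
by split; [exact: BC_rcoact_llin | exact: BC_rcoact_rlin].
Qed.

Definition C_act (t : T) (c : C) : C := ev (pr t) (Delta c).
Definition BC_act (t : T) : BC -> BC := tmap (M := B_A) (M' := B_A) id (C_act t).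
Definition NBC_act (N : M_D) (t : T) : tens N BC -> tens N BC := tmap id (BC_act t).

Lemma C_act_llin t : llinear (C_act t).
Proof. exact: llin_comp (ev_llin (pr t)) (Delta_l C). Qed.
Lemma BC_act_llin t : llinear (BC_act t).
Proof. by apply: (tmap_llin (X := B_A) (X' := B_A)) => //; exact: C_act_llin. Qed.
Lemma ev_BC t x : ev (pr t) (BC_rcoact x) = BC_act t x.
Proof.
have DL := Delta_l C; have CL := C_act_llin t.
rewrite /BC_rcoact /BC_act; elim/tens_ind: x => [b c|x y hx hy].
  by rewrite !tmapE // ev_tassocV.
by rewrite !tmapD // tassocVD evD hx hy.
Qed.
Lemma ev_NBC (N : M_D) t (z : tens N BC) : ev (pr t) (NBC_rcoact z) = NBC_act t z.
Proof.
have DL := BC_rcoact_llin; have CL := BC_act_llin t.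
rewrite /NBC_rcoact /NBC_act; elim/tens_ind: z => [b c|x y hx hy].
  by rewrite !tmapE // ev_tassocV ev_BC.
by rewrite !tmapD // tassocVD evD hx hy.
Qed.
Lemma C_act1 c : C_act (ar_unit T 1) c = c.
Proof.
rewrite /C_act -[RHS]counitr; congr (ev _ _).
by apply: funext => d; rewrite pr_unit.
Qed.
Lemma C_actM t u c : C_act (ar_mul t u) c = C_act u (C_act t c).
Proof.
rewrite /C_act.
rewrite -(ev_ev (f := pr t) (g := pr u) (coassoc c)); last exact: pr_mul.
congr (ev _ _).
by apply: (ev_tmap (h := @Delta A C : C -> tens_r C C)) => //; exact: Delta_r.
Qed.
Lemma NBC_act1 (N : M_D) (z : tens N BC) : NBC_act (ar_unit T 1) z = z.
Proof.
have e1 : C_act (ar_unit T 1) = id by apply: funext; exact: C_act1.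
have e2 : BC_act (ar_unit T 1) = id.
  by apply: funext => x; rewrite /BC_act e1; exact: (tmap_id (M := B_A)).
by rewrite /NBC_act e2 tmap_id.
Qed.
Lemma NBC_actM (N : M_D) t u (z : tens N BC) :
  NBC_act (ar_mul t u) z = NBC_act u (NBC_act t z).
Proof.
have CL v := C_act_llin v; have BL v := BC_act_llin v.
rewrite /NBC_act tmap_comp //; congr (tmap _ _ _).
apply: funext => x; rewrite /BC_act /= tmap_comp //; congr (tmap _ _ _).
by apply: funext => c; exact: C_actM.
Qed.

Lemma Delta_C_act t c : Delta (C_act t c) = tmap id (C_act t) (Delta c).
Proof.
have DL := Delta_l C; have CL := C_act_llin t.
transitivity (ev (pr t) (tassocV (tmap id (@Delta A C) (Delta c)))).
  rewrite -coassoc tassocK; apply/esym.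
  by apply: (ev_tmap (h := @Delta A C : C -> tens_r C C)) => //; exact: Delta_r.
elim/tens_ind: (Delta c) => [c1 c2|x y hx hy].
  by rewrite !tmapE // ev_tassocV.
by rewrite !tmapD // tassocVD evD hx hy.
Qed.
Lemma BC_lcoact_act t x :
  BC_lcoact (BC_act t x) = tmap id (BC_act t) (BC_lcoact x).
Proof.
have CL := C_act_llin t; have BL := BC_act_llin t.
elim/tens_ind: x => [b c|x y hx hy]; last first.
  by rewrite (proj1 BL) !BC_lcoactD tmapD // hx hy.
rewrite /BC_act tmapE // !BC_lcoactE Delta_C_act.
have [_ ->] := tmap_llin (X := D) (X' := D) (f := id) (conj (@llin_id _ _) (@rlin_id _ _)) BL.
congr (_ *: _); elim/tens_ind: (Delta c) => [c1 c2|x y hx hy].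
  by rewrite tmapE // !theta2E tmapE //; congr (_ ⊗ _); rewrite /BC_act tmapE.
by rewrite tmapD // !theta2D tmapD // hx hy.
Qed.

Section Cotensor.
Variable N : M_D.
Let rhoN : rlinear (@rho B D N : N -> tens_r N D) := rhoP N.

(* \sum n_0 ⊗ n_1 ⊗ x and \sum n ⊗ x_{-1} ⊗ x_0 *)
Definition cot_l (z : tens N BC) : tens N (tens D BC) :=
  tassoc (tmap (M' := tens_r N D) (@rho B D N) id z).
Definition cot_r (z : tens N BC) : tens N (tens D BC) := tmap id BC_lcoact z.

Fact cot_lD x y : cot_l (x + y) = cot_l x + cot_l y.
Proof. by rewrite /cot_l tmapD // tassocD. Qed.
Fact cot_rD x y : cot_r (x + y) = cot_r x + cot_r y.
Proof. by rewrite /cot_r tmapD //; exact: BC_lcoact_llin. Qed.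
Fact cot_lR (z : tens_r N BC) a :
  cot_l (z *< a) = (cot_l z : tens_r N (tens_b D BC)) *< a.
Proof.
elim/tens_ind: z => [n x|x y hx hy]; last by rewrite ractDl !cot_lD ractDl hx hy.
rewrite tens_actE /cot_l !tmapE //=; elim/tens_ind: (rho n) => [m d|u v hu hv].
  rewrite !tassocE [RHS](tens_actE (Y := tens_b D BC)).
  by congr (_ ⊗ _); exact: esym (@tens_actE B A D BC d x a).
by rewrite !tpureDl !tassocD [RHS](@ractDl _ (tens_r N (tens_b D BC))) hu hv.
Qed.
Fact cot_rR (z : tens_r N BC) a :
  cot_r (z *< a) = (cot_r z : tens_r N (tens_b D BC)) *< a.
Proof.
have h := tmap_rlin (Y' := tens_b D BC) (@rlin_id B N)
  (conj BC_lcoact_llin BC_lcoact_rlin).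
exact: (proj2 h).
Qed.
Fact cotensor0 : cot_l 0 = cot_r 0.
Proof. by rewrite (morph0 cot_lD) (morph0 cot_rD). Qed.
Fact cotensorD x y : cot_l x = cot_r x -> cot_l y = cot_r y -> cot_l (x + y) = cot_r (x + y).
Proof. by move=> hx hy; rewrite cot_lD cot_rD hx hy. Qed.
Fact cotensorZ (x : tens_r N BC) a : cot_l x = cot_r x -> cot_l (x *< a) = cot_r (x *< a).
Proof. by move=> hx; rewrite cot_lR cot_rR hx. Qed.
Definition cotensor : submod (tens_r N BC) :=
  @Submod A (tens_r N BC) (fun z => cot_l z = cot_r z) cotensor0 cotensorD cotensorZ.

Fact cot_act t z : cotensor z -> cotensor (NBC_act t z).
Proof.
have BL := BC_act_llin t.
have tL := tmap_llin (X := D) (X' := D) (f := id) (conj (@llin_id _ _) (@rlin_id _ _)) BL.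
move=> /= hz; transitivity (tmap id (tmap id (BC_act t)) (cot_l z)); last first.
  rewrite hz /cot_r /NBC_act !tmap_comp //; try exact: BC_lcoact_llin.
  by congr (tmap _ _ _); apply: funext => x /=; rewrite BC_lcoact_act.
elim/tens_ind: z {hz} => [n x|x y hx hy]; last first.
  by rewrite [NBC_act _ _]tmapD // !cot_lD tmapD // hx hy.
rewrite [NBC_act _ _]tmapE // /cot_l !tmapE //=.
elim/tens_ind: (rho n) => [m d|u v hu hv]; first by rewrite !tassocE !tmapE.
by rewrite !tpureDl !tassocD tmapD // hu hv.
Qed.
Let r (x : sub_rmod cotensor) : tens_r (tens_r N BC) C := NBC_rcoact (sval x).
Let act (x : sub_rmod cotensor) (t : T) : sub_rmod cotensor :=
  exist _ (NBC_act t (sval x)) (cot_act t (svalP x)).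
Fact cot_inj : injective (sval : sub_rmod cotensor -> tens_r N BC).
Proof. by move=> x y /sub_eq. Qed.
Fact cot_r_lin : rlinear r.
Proof. exact: rlin_comp (@NBC_rcoact_rlin N) (@sval_rlin _ _ cotensor). Qed.
Fact cot_act_r x t : sval (act x t) = ev (pr t) (r x).
Proof. by rewrite ev_NBC. Qed.
Fact cot_act1 x : act x (ar_unit T 1) = x.
Proof. by apply: sub_eq; exact: NBC_act1. Qed.
Fact cot_actM x t u : act x (ar_mul t u) = act (act x t) u.
Proof. by apply: sub_eq; exact: NBC_actM. Qed.
(* The coaction is the restriction of NBC_rcoact (lift_rhoE). *)
Definition cot_ob : comodule C :=
  lift_comodule hP (@sval_rlin _ _ cotensor) cot_inj cot_r_lin cot_act_r
    cot_act1 cot_actM.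
End Cotensor.

Lemma tmap_swap (N N' : M_D) (g : N -> N') (h : BC -> BC) (z : tens N BC) :
  rlinear g -> llinear h ->
  tmap g id (tmap id h z) = tmap id h (tmap g id z).
Proof. by move=> hg hh; rewrite !tmap_comp. Qed.

Section CotensorMor.
Variables (N N' : M_D) (g : colin N N').
Let gL := cl_lin g.
Fact cot_mor_cot (z : tens N BC) : cotensor N z -> cotensor N' (tmap g id z).
Proof.
have RN := rhoP N; have RN' := rhoP N'; have LL := BC_lcoact_llin.
move=> /= hz; transitivity (tmap g id (cot_l z)).
  elim/tens_ind: z {hz} => [n x|x y hx hy]; last by rewrite !(tmapD, cot_lD) // hx hy.
  rewrite /cot_l !tmapE //= -cl_rho; elim/tens_ind: (rho n) => [m d|u v hu hv].
    by rewrite tmapE // !tassocE tmapE.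
  by rewrite (tmapD gL) // !tpureDl !tassocD tmapD // hu hv.
by rewrite hz /cot_r !tmap_comp.
Qed.
Definition cot_mor_fun (x : cot_ob N) : cot_ob N' :=
  exist _ (tmap g id (sval x)) (cot_mor_cot (svalP x)).
Fact cot_mor_lin : rlinear cot_mor_fun.
Proof.
have [hD hR] := tmap_rlin (Y := BC) (Y' := BC) gL (conj (@llin_id _ _) (@rlin_id _ _)).
by split=> x y; apply: sub_eq; [exact: hD | exact: hR].
Qed.
Fact cot_mor_act t x :
  cot_mor_fun (ev (pr t) (rho x)) = ev (pr t) (rho (cot_mor_fun x)).
Proof.
rewrite !ev_lift_rho; apply: sub_eq.
by apply: tmap_swap => //; exact: BC_act_llin.
Qed.
Definition cot_mor : colin (cot_ob N) (cot_ob N') := lift_colin hP cot_mor_lin cot_mor_act.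
End CotensorMor.

Fact cot_id (N : M_D) x : cot_mor (colin_id N) x = x.
Proof. by apply: sub_eq; exact: tmap_id. Qed.
Fact cot_comp (N N' N'' : M_D) (g : colin N' N'') (h : colin N N') x :
  cot_mor (colin_comp g h) x = cot_mor g (cot_mor h x).
Proof.
apply: sub_eq; rewrite /= tmap_comp //; [exact: cl_lin | exact: cl_lin].
Qed.
Definition Cotensor_BC : cofunctor D C := Cofunctor cot_id cot_comp.

(* s^op (n ⊗ x) = \sum n_0 <s, n_1> ⊗ x and
   (n ⊗ x) s^op = \sum n ⊗ <s, x_{-1}> x_0 *)
Definition sop_l (N : M_D) (s : S) : tens N BC -> tens N BC :=
  tmap (fun n => ev (pr s) (rho n)) id.
Definition BC_sop (s : S) (x : BC) : BC :=
  tlift (fun (d : D) (y : BC) => pr s d *: y) (BC_lcoact x).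
Definition sop_r (N : M_D) (s : S) : tens N BC -> tens N BC := tmap id (BC_sop s).

(* kappa_Q (S) is contained in the set of B-bilinear maps. *)
Definition kappa_bilinear : Prop :=
  forall (s : S) (d : D) (b : B), pr s (d *< b) = pr s d * b.

Definition Sop_bimodule_map (N : M_D) (h : (ring_of S)^c -> tens N BC) : Prop :=
  [/\ forall u v, h (u + v) = h u + h v,
      forall s u : (ring_of S)^c, h (s * u) = sop_l s (h u) &
      forall u s : (ring_of S)^c, h (u * s) = sop_r s (h u)].

Section HomSop.
Hypothesis hQ : kappa_bilinear.

Fact act_rlin (N : M_D) s : rlinear (fun n : N => ev (pr s) (rho n)).
Proof.
have [rD rR] := rhoP N; split=> [x y|x b]; first by rewrite rD evD.
rewrite rR; elim/tens_ind: (rho x) => [n d|u v hu hv].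
  by rewrite tens_actE !evE hQ ractA.
by rewrite ractDl !evD ractDl hu hv.
Qed.
Fact sop_bal s : balanced (fun (d : D) (y : BC) => pr s d *: y).
Proof.
split=> *; first by rewrite ldD scalerDl.
- exact: scalerDr.
- by rewrite hQ scalerA.
Qed.
Fact BC_sop_bilin s : bilin (BC_sop s).
Proof.
have hb := sop_bal s; have [lD lZ] := BC_lcoact_llin; have [_ lR] := BC_lcoact_rlin.
split; split=> [x y|]; rewrite /BC_sop; try by rewrite lD (tliftD hb).
- move=> b x; rewrite lZ; elim/tens_ind: (BC_lcoact x) => [d y|u v hu hv].
    by rewrite tens_scaleE !(tlift_pure hb) ldZ scalerA.
  by rewrite scalerDr !(tliftD hb) scalerDr hu hv.
- move=> x a; rewrite lR; elim/tens_ind: (BC_lcoact x) => [d y|u v hu hv].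
    by rewrite tens_actE !(tlift_pure hb); exact: esym (bactZ _ _ _).
  by rewrite ractDl !(tliftD hb) ractDl hu hv.
Qed.
Fact BC_sop_act s t x : BC_sop s (BC_act t x) = BC_act t (BC_sop s x).
Proof.
have hb := sop_bal s; have BL := BC_act_llin t.
rewrite /BC_sop BC_lcoact_act; elim/tens_ind: (BC_lcoact x) => [d y|u v hu hv].
  by rewrite tmapE // !(tlift_pure hb) (proj2 BL).
by rewrite tmapD // !(tliftD hb) (proj1 BL) hu hv.
Qed.

Section HomSopObj.
Variable N : M_D.
Local Notation E := (tens_r N BC).
Lemma sop_l_rlin s : rlinear (@sop_l N s : E -> E).
Proof. by apply: tmap_rlin => //; exact: act_rlin. Qed.
Lemma sop_r_rlin s : rlinear (@sop_r N s : E -> E).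
Proof. by apply: tmap_rlin => //; exact: BC_sop_bilin. Qed.
Local Notation F := (fmod_rmod (ring_of S)^c E).
Fact homsop0 : Sop_bimodule_map (0 : F).
Proof.
split=> *; first exact: esym (addr0 _).
- by apply/esym; exact: (morph0 (proj1 (sop_l_rlin _))).
- by apply/esym; exact: (morph0 (proj1 (sop_r_rlin _))).
Qed.
Fact homsopD (h k : F) : Sop_bimodule_map h -> Sop_bimodule_map k ->
  Sop_bimodule_map (h + k).
Proof.
move=> [hD hl hr] [kD kl kr].
split=> u v; rewrite -[(h + k) _]/(h _ + k _).
- by rewrite hD kD addrACA.
- by rewrite hl kl; exact: esym (proj1 (sop_l_rlin _) _ _).
- by rewrite hr kr; exact: esym (proj1 (sop_r_rlin _) _ _).
Qed.
Fact homsopZ (h : F) a : Sop_bimodule_map h -> Sop_bimodule_map (h *< a).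
Proof.
move=> [hD hl hr]; split=> u v; rewrite -[(h *< a) _]/((h _ : E) *< a).
- by rewrite hD; exact: ractDl.
- by rewrite hl; exact: esym (proj2 (sop_l_rlin _) _ _).
- by rewrite hr; exact: esym (proj2 (sop_r_rlin _) _ _).
Qed.
Definition HomSop : submod F := @Submod A F (@Sop_bimodule_map N) homsop0 homsopD homsopZ.

Fact homsop_act (t : T) (h : F) : HomSop h -> HomSop (fun s => NBC_act t (h s) : E).
Proof.
have BL := BC_act_llin t; have AL s := act_rlin N s.
have SL s := proj1 (BC_sop_bilin s).
move=> [hD hl hr]; split=> u v.
- by rewrite hD; exact: tmapD.
- by rewrite hl /NBC_act /sop_l tmap_swap.
- rewrite hr /NBC_act /sop_r !tmap_comp //; congr (tmap _ _ _).
  by apply: funext => x /=; rewrite BC_sop_act.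
Qed.
Let K := sub_rmod HomSop.
Definition homsop_ev1 (h : K) : E := (sval h : F) 1.
Fact homsop_ev1_lin : rlinear homsop_ev1. Proof. by []. Qed.
Fact homsop_ev1_inj : injective homsop_ev1.
Proof.
move=> [h hh] [k hk]; rewrite /homsop_ev1 /= => e; apply: sub_eq => /=.
apply: funext => s; have [_ hl _] := hh; have [_ kl _] := hk.
by rewrite -[s]mulr1 hl kl e.
Qed.
Let r (h : K) : tens_r E C := NBC_rcoact (homsop_ev1 h).
Let act (h : K) (t : T) : K :=
  exist _ (fun s => NBC_act t ((sval h : F) s) : E) (homsop_act t (svalP h)).
Fact homsop_r_lin : rlinear r.
Proof. exact: rlin_comp (@NBC_rcoact_rlin N) homsop_ev1_lin. Qed.
Fact homsop_act_r h t : homsop_ev1 (act h t) = ev (pr t) (r h).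
Proof. by rewrite ev_NBC. Qed.
Fact homsop_act1 h : act h (ar_unit T 1) = h.
Proof. by apply: sub_eq; apply: funext => s; exact: NBC_act1. Qed.
Fact homsop_actM h t u : act h (ar_mul t u) = act (act h t) u.
Proof. by apply: sub_eq; apply: funext => s; exact: NBC_actM. Qed.
(* Hom_{S^op-S^op}(S^op, N ⊗_B (B ⊗_A C)): the right A-action and the right
   C-coaction are those induced by N ⊗_B (B ⊗_A C); the coaction is
   determined by its value under h |-> h 1, which is injective. *)
Definition homsop_ob : comodule C :=
  lift_comodule hP homsop_ev1_lin homsop_ev1_inj homsop_r_lin homsop_act_r
    homsop_act1 homsop_actM.
End HomSopObj.

Section HomSopMor.
Variables (N N' : M_D) (g : colin N N').
Let gL := cl_lin g.
Fact homsop_mor_hom (h : fmod_rmod (ring_of S)^c (tens_r N BC)) :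
  HomSop N h -> HomSop N' (fun s => tmap g id (h s) : tens_r N' BC).
Proof.
have AL s := act_rlin N s; have AL' s := act_rlin N' s.
have SL s := proj1 (BC_sop_bilin s).
move=> [hD hl hr]; split=> u v.
- by rewrite hD; exact: tmapD.
- rewrite hl /sop_l !tmap_comp //; congr (tmap _ _ _).
  by apply: funext => n /=; exact: (proj2 (colin_act g)).
- by rewrite hr /sop_r tmap_swap.
Qed.
Definition homsop_mor_fun (x : homsop_ob N) : homsop_ob N' :=
  exist _ (fun s => tmap g id ((sval x : fmod _ _) s) : tens_r N' BC)
    (homsop_mor_hom (svalP x)).
Fact homsop_mor_lin : rlinear homsop_mor_fun.
Proof.
have [hD hR] := tmap_rlin (Y := BC) (Y' := BC) gL (conj (@llin_id _ _) (@rlin_id _ _)).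
by split=> x y; apply: sub_eq; apply: funext => s; [exact: hD | exact: hR].
Qed.
Fact homsop_mor_act t x :
  homsop_mor_fun (ev (pr t) (rho x)) = ev (pr t) (rho (homsop_mor_fun x)).
Proof.
rewrite !ev_lift_rho; try exact: homsop_ev1_inj.
apply: sub_eq; apply: funext => s.
by apply: tmap_swap => //; exact: BC_act_llin.
Qed.
Definition homsop_mor : colin (homsop_ob N) (homsop_ob N') :=
  lift_colin hP homsop_mor_lin homsop_mor_act.
End HomSopMor.

Fact homsop_id (N : M_D) x : homsop_mor (colin_id N) x = x.
Proof. by apply: sub_eq; apply: funext => s; exact: tmap_id. Qed.
Fact homsop_comp (N N' N'' : M_D) (g : colin N' N'') (h : colin N N') x :
  homsop_mor (colin_comp g h) x = homsop_mor g (homsop_mor h x).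
Proof.
by apply: sub_eq; apply: funext => s; rewrite /= tmap_comp //; exact: cl_lin.
Qed.
Definition HomSop_BC : cofunctor D C := Cofunctor homsop_id homsop_comp.
End HomSop.
End Functors.

(* Main.v *)
(* Since P is an alpha-pairing, z = \sum n_i ⊗ c_i in N ⊗_A C is determined by
   the function w(t) = \sum n_i beta(<t, c_i>) from T to N, and z lies in the
   cotensor product iff w(t) s = w(t xi(s)) for all s and t.  The coinduced
   comodule consists of the rational phi, and z corresponds to
   phi(t ⊗ b) = w(t) b.  For general b the S-linearity of this phi, and the fact
   that every rational phi is determined by the phi(t ⊗ 1), come from the
   inclusion beta(eps C) B ⊆ beta(A), which the existence of xi forces, together
   with the counit identities.  When kappa_Q(S) consists of bilinear maps, the
   same criterion reads s z = z s, i.e. z is the value at 1 of a bimodule map. *)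
Require Import Defs.
From mathcomp Require Import all_boot all_algebra.
From mathcomp Require Import boolp.
Set Implicit Arguments.
Unset Strict Implicit.
Unset Printing Implicit Defensive.
Import GRing.Theory.
Local Open Scope ring_scope.

(** * Natural isomorphisms from objectwise bijections *)

Section NatIso.
Variables (A B : pzRingType) (D : coring B) (C : coring A).

Section Inverse.
Variables (M N : comodule C) (g : colin M N) (h : N -> M).
Hypotheses (gK : cancel g h) (hK : cancel h g).
Fact colin_inv_lin : rlinear h.
Proof.
by have [gD gZ] := cl_lin g; split=> x y; apply: (can_inj gK);
  rewrite hK (gD, gZ) !hK.
Qed.
Fact colin_inv_rho x : tmap h id (rho x) = rho (h x).
Proof.
rewrite -[in LHS](hK x) -cl_rho (tmap_comp (cl_lin g) colin_inv_lin) //.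
rewrite -[RHS]tmap_id; congr (tmap _ _ _); exact: funext.
Qed.
Definition colin_inv : colin N M := Colin colin_inv_lin colin_inv_rho.
End Inverse.

Variables F G : cofunctor D C.

(** The inverse of a colinear bijection is again colinear, so preimages chosen by [cid] already form
    a family of comodule maps. *)
Lemma nat_iso_bij (phi : forall N, colin (F N) (G N)) :
  (forall N, injective (phi N)) -> (forall N y, exists x, phi N x = y) ->
  (forall (N N' : comodule D) (g : colin N N') x,
     phi N' (cf_mor F g x) = cf_mor G g (phi N x)) ->
  nat_iso F G.
Proof.
move=> inj surj nat; pose h N y := projT1 (cid (surj N y)).
have hK N : cancel (h N) (phi N) by move=> y; rewrite /h; case: cid.
have gK N : cancel (phi N) (h N) by move=> x; apply: inj; rewrite hK.
by exists phi, (fun N => colin_inv (gK N) (hK N)).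
Qed.

Lemma nat_iso_sym : nat_iso F G -> nat_iso G F.
Proof.
move=> [phi [psi [phiK psiK nat]]]; exists psi, phi; split=> // N N' g x.
by apply: (can_inj (phiK N')); rewrite nat !psiK.
Qed.
End NatIso.

(** * Brackets with unit elements and scalar multiples *)

Section Pairing.
Variables (A : pzRingType) (P : pairing A).
Lemma prDl (t u : pr_T P) c : pr (t + u) c = pr t c + pr u c.
Proof. by rewrite /pr (proj1 (proj1 (arm_bilin (kappaP P)))). Qed.
Lemma prR (t : pr_T P) a c : pr (t *< a) c = pr t c * a.
Proof. by rewrite /pr (proj2 (proj2 (arm_bilin (kappaP P)))). Qed.
Lemma pr_ar_unit a c : pr (ar_unit (pr_T P) a) c = eps c * a.
Proof. by rewrite /pr (arm_unit (kappaP P)). Qed.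
Lemma ev_prR (M : rmod A) (t : pr_T P) a (z : tens M (pr_C P)) :
  ev (pr (t *< a)) z = ev (pr t) z *< a.
Proof.
elim/tens_ind: z => [m c|x y hx hy]; last by rewrite !evD hx hy ractDl.
by rewrite !evE prR ractA.
Qed.
Lemma rho_ar_unit (N : comodule (pr_C P)) (n : N) a :
  ev (pr (ar_unit (pr_T P) a)) (rho n) = n *< a.
Proof. by rewrite ar_unitR ev_prR [ev _ _](comod_act1 (Q := P)). Qed.
End Pairing.

(** * A [B]-valued pairing on [BC] and the cotensor criterion *)

Section Corollary.
Variables (A B : pzRingType) (beta : {rmorphism A -> B}).
Variables (P : pairing A) (Q : pairing B) (f : pairing_mor beta P Q).
Local Notation C := (pr_C P).
Local Notation T := (pr_T P).
Local Notation D := (pr_C Q).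
Local Notation S := (pr_T Q).
Local Notation B_A := (rrestr beta (reg B)).
Local Notation BC := (BC beta P).
Local Notation xi := (xi f).
Local Notation theta := (theta f).

(** The left [B]-linear extension of beta(<t, ->) to B ⊗_A C. Such forms let elements of N ⊗_B (B
    ⊗_A C) be tested by functions on [T]. *)
Definition BC_pr_fun (t : T) : BC -> B :=
  tlift (M := B_A) (N := C) (fun (b : B) c => b * beta (pr t c)).
Fact BC_pr_bal t : balanced (M := B_A) (N := C) (fun (b : B) c => b * beta (pr t c)).
Proof.
split=> [b b' c|b c c'|b a c]; first exact: mulrDl.
  by rewrite ldD rmorphD mulrDr.
by rewrite ldZ rmorphM mulrA.
Qed.
Lemma BC_pr_funE t (b : B_A) c : BC_pr_fun t (b ⊗ c) = (b : B) * beta (pr t c).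
Proof. exact: tlift_pure (BC_pr_bal t) _ _. Qed.
Fact BC_pr_llin t : llinear (BC_pr_fun t : BC -> B^o).
Proof.
have pD x y : BC_pr_fun t (x + y) = BC_pr_fun t x + BC_pr_fun t y.
  exact: tliftD (BC_pr_bal t) x y.
split=> [|b x]; first exact: pD.
elim/tens_ind: x => [b' c|x y hx hy]; last by rewrite scalerDr !pD hx hy scalerDr.
by rewrite [_ *: _](tens_scaleE (X := B_A)) !BC_pr_funE; exact: esym (mulrA _ _ _).
Qed.
Definition BC_pr t : ldual BC := Ldual (BC_pr_llin t).
Lemma BC_prE t (b : B_A) c : BC_pr t (b ⊗ c : BC) = (b : B) * beta (pr t c).
Proof. exact: BC_pr_funE. Qed.

Lemma BC_prD t x y : BC_pr t (x + y) = BC_pr t x + BC_pr t y.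
Proof. exact: proj1 (ldP (BC_pr t)) x y. Qed.

Lemma ev_BC_prE (M : rmod B) t (m : M) (b : B) c :
  ev (BC_pr t) (m ⊗ (tpure (M := B_A) b c : BC)) = m *< b *< beta (pr t c).
Proof. by rewrite evE BC_prE ractA. Qed.

Hypothesis hP : alpha_pairing P.

(** After reassociation, the alpha condition on [P] applies to the right [A]-module M ⊗_B B; the map
    m |-> m ⊗ 1 carries the [B]-valued pairing to the one there. *)
Lemma BC_alpha (M : rmod B) (z z' : tens M BC) :
  (forall t, ev (BC_pr t) z = ev (BC_pr t) z') -> z = z'.
Proof.
move=> e; rewrite -[z]tassocVK -[z']tassocVK; congr tassoc.
apply: (ev_inj hP) => t.
pose i (m : M) : tens_r M B_A := m ⊗ (1 : B_A).
have iE (w : tens M BC) : ev (pr t) (tassocV w) = i (ev (BC_pr t) w).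
  elim/tens3_ind: w => [m b c|x y hx hy].
    rewrite tassocVE evE ev_BC_prE tens_actE /i ractA tpureA; congr (_ ⊗ _).
    exact: esym (mulr1 _).
  by rewrite tassocVD !evD hx hy /i tpureDl.
by rewrite !iE e.
Qed.

Lemma pr_C_act (t u : T) c : pr t (C_act u c) = pr (ar_mul u t) c.
Proof. exact: pr_mul. Qed.

Lemma BC_pr_act t u (x : BC) : BC_pr t (BC_act u x) = BC_pr (ar_mul u t) x.
Proof.
have CL := @C_act_llin _ P u; have [aD _] := @BC_act_llin _ _ beta P u.
elim/tens_ind: x => [b c|x y hx hy]; last by rewrite aD !BC_prD hx hy.
by rewrite /BC_act [tmap _ _ _]tmapE // !BC_prE pr_C_act.
Qed.

Lemma ev_NBC_act (N : comodule D) t u (z : tens N BC) :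
  ev (BC_pr t) (NBC_act u z) = ev (BC_pr (ar_mul u t)) z.
Proof.
apply: (ev_tmap (h := id)) => //; first exact: BC_act_llin.
by move=> x; exact: BC_pr_act.
Qed.

Lemma pr_theta s (b : B) c : pr s (b *: theta c) = b * beta (pr (xi s) c).
Proof. by rewrite ldZ theta_xi. Qed.

Lemma ev_BC_lcoact t (b : B_A) c :
  ev (BC_pr t) (BC_lcoact f (b ⊗ c)) = (b : B) *: theta (C_act t c).
Proof.
have [_ evZ] := @ev_llinear _ _ D _ (BC_pr t).
rewrite BC_lcoactE evZ /C_act; congr (_ *: _).
elim/tens_ind: (Delta c) => [c1 c2|x y hx hy].
  by rewrite theta2E ev_BC_prE ract1 evE thetaR.
by rewrite theta2D !evD thetaD hx hy.
Qed.

(** Adjointness of [theta] and [xi] turns the left [D]-coaction of [BC] into right multiplication by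
    xi(s) in [T]. *)
Lemma pr_BC_lcoact t s (x : BC) :
  pr s (ev (BC_pr t) (BC_lcoact f x) : D) = BC_pr (ar_mul t (xi s)) x.
Proof.
elim/tens_ind: x => [b c|x y hx hy].
  by rewrite ev_BC_lcoact pr_theta pr_C_act BC_prE.
by rewrite BC_lcoactD evD ldD BC_prD hx hy.
Qed.

Hypothesis hQ : alpha_pairing Q.

Lemma ev_cot_r (N : comodule D) t s (z : tens N BC) :
  ev (pr s) (ev (BC_pr t) (tassocV (cot_r f z)) : tens N D)
    = ev (BC_pr (ar_mul t (xi s))) z.
Proof.
elim/tens_ind: z => [n x|x y hx hy]; last by rewrite cot_rD tassocVD !evD hx hy.
rewrite /cot_r tmapE //; last exact: BC_lcoact_llin.
by rewrite ev_tassocV evE pr_BC_lcoact evE.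
Qed.

(** Equality in N ⊗_B D ⊗_B BC is tested in two stages: on [BC] by the alpha condition of [P], then
    on [D] by that of [Q]. *)
Lemma cotensorP (N : comodule D) (z : tens N BC) :
  cotensor f N z <-> forall t s,
    ev (pr s) (rho (ev (BC_pr t) z)) = ev (BC_pr (ar_mul t (xi s))) z.
Proof.
have rN := rhoP N.
have el t : ev (BC_pr t) (tassocV (cot_l z)) = rho (ev (BC_pr t) z).
  by rewrite /cot_l tassocK; exact: (ev_tmap (h := @rho B D N : N -> tens_r N D)).
split=> [/= e t s|h /=]; first by rewrite -el e ev_cot_r.
rewrite -[LHS]tassocVK -[RHS]tassocVK; congr tassoc.
apply: BC_alpha => t; rewrite el; apply: (ev_inj hQ) => s.
by rewrite ev_cot_r.
Qed.

(** * Right [B]-linearity of brackets on the image of [theta] *)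

Section Coinduction.
Variable TBs : TB_structure f.
Local Notation B_l := (lrestr beta (reg B)).
Local Notation tb t b := (tpure (M := T) (N := B_l) t b).

(* Pairing theta c with b 1_S shows that eps C generates a right ideal of B
   inside the image of A. *)
Lemma eps_beta (c : C) (b : B) : exists a, beta (eps c) * b = beta a.
Proof.
exists (pr (xi (ar_unit S b)) c).
by rewrite -theta_xi pr_ar_unit (crm_eps (thetaP f)).
Qed.

Definition TB_eval_fun (c : C) : TB beta P -> B :=
  tlift (M := T) (N := B_l) (fun t (b : B) => beta (pr t c) * b).
Lemma TB_eval_bal c : balanced (M := T) (N := B_l) (fun t (b : B) => beta (pr t c) * b).
Proof.
split=> [t u b|t b b'|t a b]; first by rewrite prDl rmorphD mulrDl.
  exact: mulrDr.
by rewrite prR rmorphM -mulrA.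
Qed.
Lemma TB_evalE c t (b : B) : TB_eval_fun c (tb t b) = beta (pr t c) * b.
Proof. exact: tlift_pure (TB_eval_bal c) t b. Qed.

(* Both sides are values of c on 1 ⊗ beta a = a ⊗ 1, acted upon by s. *)
Lemma pr_theta_beta s c a : pr s (theta c *< beta a) = pr s (theta c) * beta a.
Proof.
have u1 := ar_mul1l (xi s).
have e : tb (a *: xi s) 1 = tb (xi s) (beta a).
  have h : tb (ar_unit T 1 *< a) 1 = tb (ar_unit T 1) (beta a).
    by rewrite tpureA; congr (_ ⊗ _); exact: mulr1.
  have := congr1 (fun x => tb_act TBs x s) h.
  by rewrite !tb_actE u1 ar_mul_ract ar_mul1l.
rewrite -thetaR !theta_xi prZ -[LHS]mulr1 -TB_evalE e.
exact: TB_evalE.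
Qed.

(** By the right counit identity, theta(c) b is the sum of the theta(c_1) beta(eps c_2) b, and
    [eps_beta] writes each beta(eps c_2) b as some beta(a), the case already settled. *)
Lemma pr_thetaR s c (b : B) : pr s (theta c *< b) = pr s (theta c) * b.
Proof.
rewrite -[c]C_act1 /C_act; elim/tens_ind: (Delta c) => [c1 c2|x y hx hy].
  rewrite evE pr_unit thetaR ractA; have [a e] := eps_beta c2 b.
  by rewrite e !pr_theta_beta -e mulrA.
by rewrite evD thetaD ractDl !ldD hx hy mulrDl.
Qed.

(** Since [xi] is only [A]-linear, b cannot leave xi(b s) directly; transposing to theta(C) turns it
    into right multiplication by b, which [pr_thetaR] extracts. *)
Lemma BC_pr_xiZ t s (b : B) x :
  BC_pr (ar_mul t (xi (b *: s))) x = BC_pr (ar_mul t (xi s)) x * b.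
Proof.
elim/tens_ind: x => [b' c|x y hx hy]; last by rewrite !BC_prD hx hy mulrDl.
by rewrite !BC_prE -!pr_C_act -!theta_xi -prZ pr_thetaR mulrA.
Qed.

(** * Cotensor elements as rational homomorphisms, and back *)

Section Object.
Variable N : comodule D.
Local Notation E := (tens_r N BC).
Local Notation H := (rres (Hom_TB TBs N)).

Lemma ev_BC_prDl t u (z : E) :
  ev (BC_pr (t + u)) z = ev (BC_pr t) z + ev (BC_pr u) z.
Proof.
elim/tens3_ind: z => [n b c|x y hx hy]; last by rewrite !evD hx hy addrACA.
by rewrite !ev_BC_prE prDl rmorphD ractDr.
Qed.
Lemma ev_BC_prR t a (z : E) : ev (BC_pr (t *< a)) z = ev (BC_pr t) z *< beta a.
Proof.
elim/tens3_ind: z => [n b c|x y hx hy]; last by rewrite !evD hx hy ractDl.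
by rewrite !ev_BC_prE prR rmorphM -ractA.
Qed.
Lemma ev_BC_prZ t a (z : E) : ev (BC_pr (a *: t)) z = ev (BC_pr t) (z *< a).
Proof.
elim/tens3_ind: z => [n b c|x y hx hy]; last by rewrite ractDl !evD hx hy.
rewrite tens_actE [_ *< a](tens_actE (M := B_A)).
by rewrite !ev_BC_prE prZ.
Qed.
Lemma ev_BC_pr_xiZ t s (b : B) (z : E) :
  ev (BC_pr (ar_mul t (xi (b *: s)))) z = ev (BC_pr (ar_mul t (xi s))) z *< b.
Proof.
elim/tens_ind: z => [n x|x y hx hy]; last by rewrite !evD hx hy ractDl.
by rewrite !evE BC_pr_xiZ ractA.
Qed.

Definition cot_hom_fun (z : E) : TB_rmod TBs -> N :=
  tlift (M := T) (N := B_l) (fun t (b : B) => ev (BC_pr t) z *< b).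
Lemma cot_hom_bal (z : E) :
  balanced (M := T) (N := B_l) (fun t (b : B) => ev (BC_pr t) z *< b).
Proof.
split=> [t u b|t b b'|t a b]; first by rewrite ev_BC_prDl ractDl.
  exact: ractDr.
by rewrite ev_BC_prR ractA.
Qed.
Lemma cot_hom_funE z t (b : B) : cot_hom_fun z (tb t b) = ev (BC_pr t) z *< b.
Proof. exact: tlift_pure (cot_hom_bal z) t b. Qed.
Lemma cot_hom_funD z x y :
  cot_hom_fun z (x + y) = cot_hom_fun z x + cot_hom_fun z y.
Proof. exact: tliftD (cot_hom_bal z) x y. Qed.

Lemma cot_hom_lin (z : cot_ob f hP N) :
  rlinear (cot_hom_fun (sval z) : TB_rmod TBs -> comod_rmod N).
Proof.
split=> [x y|x s]; first exact: cot_hom_funD.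
elim/tens_ind: x => [t b|x y hx hy]; last first.
  by rewrite ractDl !cot_hom_funD ractDl hx hy.
(* With w(t) the pairing of z with t, absorbing b as w(t xi(s)) b = w(t xi(b s)) makes the cotensor
   criterion applicable to b s. *)
rewrite [_ *< _](tb_actE TBs) !cot_hom_funE -ev_BC_pr_xiZ.
have /cotensorP <- := svalP z; apply/esym.
rewrite [LHS](_ : _ = ev (pr (s : S)) (rho (ev (BC_pr t) (sval z) *< b))) //.
by rewrite (proj2 (rhoP N)) (ev_ract (g := pr ((b : B) *: (s : S)))) //; exact: prZ.
Qed.
Definition cot_hom (z : cot_ob f hP N) : H := Rhom (cot_hom_lin z).

Lemma rhom_TB_eq (phi psi : Hom_TB TBs N) :
  (forall t b, phi (tb t b) = psi (tb t b)) -> phi = psi.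
Proof.
move=> e; apply: rhom_eq => x.
by elim/tens_ind: x => [t b|x y hx hy]; rewrite ?e // !rhD hx hy.
Qed.

Lemma Hom_TB_actE (phi : Hom_TB TBs N) (t u : T) (b : B) :
  (phi *< (t : ring_of T)) (tb u b) = phi (tb (ar_mul t u) b).
Proof. by congr (rh_fun phi _); exact: TB_lmulE. Qed.

Lemma cot_homE z t b : cot_hom z (tb t b) = ev (BC_pr t) (sval z) *< b.
Proof. exact: cot_hom_funE. Qed.

Lemma cot_hom_rlin : rlinear cot_hom.
Proof.
split=> [x y|x a]; apply: rhom_TB_eq => t b.
  by rewrite [RHS](_ : _ = cot_hom x (tb t b) + cot_hom y (tb t b)) // !cot_homE evD ractDl.
by rewrite Hom_TB_actE !cot_homE ar_mul_unitl ev_BC_prZ.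
Qed.

Lemma cot_hom_act (z : cot_ob f hP N) t :
  cot_hom (ev (pr t) (rho z)) = (cot_hom z : Hom_TB TBs N) *< (t : ring_of T).
Proof.
apply: rhom_TB_eq => u b; rewrite Hom_TB_actE !cot_homE -ev_NBC_act.
by rewrite ev_lift_rho //; exact: cot_inj.
Qed.

Lemma cot_hom_rational z : rational (cot_hom z : Hom_TB TBs N).
Proof.
(* The witness is the coaction of z pushed forward along [cot_hom]. *)
exists (tmap cot_hom id (rho z)) => t; rewrite -cot_hom_act.
by apply/esym; exact: (ev_tmap (g := pr t) _ cot_hom_rlin).
Qed.
Definition cot_coind (z : cot_ob f hP N) : Coind_ob hP TBs N :=
  exist _ (cot_hom z) (cot_hom_rational z).
Lemma cot_coind_lin : rlinear cot_coind.
Proof.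
by have [hD hZ] := cot_hom_rlin; split=> x y; apply: sub_eq; [exact: hD | exact: hZ].
Qed.
Lemma cot_coind_act t z :
  cot_coind (ev (pr t) (rho z)) = ev (pr t) (rho (cot_coind z)).
Proof.
rewrite [RHS]ev_lift_rho; last exact: rat_iota_inj.
by apply: sub_eq; exact: cot_hom_act.
Qed.
Definition cot_coind_colin : colin (cot_ob f hP N) (Coind_ob hP TBs N) :=
  lift_colin hP cot_coind_lin cot_coind_act.

(** Evaluation at t ⊗ 1 recovers the pairing of z with t, and by [BC_alpha] these pairings determine
    z. *)
Lemma cot_coind_inj : injective cot_coind.
Proof.
move=> z z' e; apply: sub_eq; apply: BC_alpha => t.
rewrite -[LHS]ract1 -[RHS]ract1 -!cot_homE.
have -> // : cot_hom z = cot_hom z'.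
exact: (congr1 (fun x : sub_rmod (Defs.Rat _) => sval x) e).
Qed.

(** Because [xi] preserves units, t ⊗ beta(a) is t ⊗ 1 acted on by the image of beta(a) in [S], and
    phi is [S]-linear. *)
Lemma Hom_TB_beta (phi : Hom_TB TBs N) t a :
  phi (tb t (beta a)) = (phi (tb t 1) : N) *< beta a.
Proof.
have u1 : xi (ar_unit S (beta a)) = ar_unit T a by exact: arm_unit (xiP f) a.
transitivity (phi ((tb t 1 : TB_rmod TBs) *< (ar_unit S (beta a) : ring_of S))).
  congr (rh_fun phi _); rewrite [RHS]tb_actE u1 ar_mul_unitr tpureA.
  by congr (_ ⊗ _); exact: esym (mulr1 _).
rewrite rhZ; exact: rho_ar_unit.
Qed.

(* Only the values phi (1 ⊗ b) with b in beta(eps C) B are seen by the coaction of a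
   rational phi, and those b come from A. *)
Lemma rational_TBE (phi : Hom_TB TBs N) (z : tens H C) t b :
  (forall t : T, phi *< (t : ring_of T) = ev (pr t) z) ->
  phi (tb t b) = (phi (tb t 1) : N) *< b.
Proof.
move=> hz; pose ev1 (psi : H) (b : B) : N := (psi : Hom_TB TBs N) (tb (ar_unit T 1) b).
have phiE u : phi (tb t u) = ev1 (ev (pr t) z) u.
  by rewrite -hz /ev1 Hom_TB_actE ar_mul1r.
have ev1D u v b' : ev1 (u + v) b' = ev1 u b' + ev1 v b' by [].
rewrite !phiE; elim/tens_ind: z {hz phiE} => [psi c|x y hx hy]; last first.
  by rewrite evD !ev1D ractDl hx hy.
have hb : balanced (fun c1 c2 : C => eps c1 *: c2).
  have [[eD eZ] [_ eR]] := eps_bilin C.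
  split=> *; first by rewrite eD scalerDl.
    exact: scalerDr.
  by rewrite eR scalerA.
(* Expanding c as the sum of the eps(c_1) c_2 puts beta(eps c_1) in front of beta(<t, c_2>) b, so
   that [eps_beta] replaces the product by an element of beta(A). *)
rewrite evE -[c]counitl; elim/tens_ind: (Delta c) => [c1 c2|x y hx hy].
  rewrite (tlift_pure hb) ldZ.
  have ev1E a u : ev1 (psi *< a) u = (psi : Hom_TB TBs N) (tb (ar_unit T 1) (beta a * u)).
    by rewrite /ev1 Hom_TB_actE ar_mul1r ar_unitR tpureA.
  rewrite !ev1E mulr1 Hom_TB_beta.
  have [a e] := eps_beta c1 (beta (pr t c2) * b).
  by rewrite rmorphM -mulrA e Hom_TB_beta -e mulrA ractA.
by rewrite (tliftD hb) ldD ractDr !ev1D ractDl hx hy.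
Qed.

(** Supplies the preimage of a rational phi: a tensor representing phi is sent to an element whose
    pairing with t is phi(t ⊗ 1). *)
Definition coind_cot_fun : tens H C -> tens N BC :=
  tlift (fun (psi : H) c =>
    ((psi : Hom_TB TBs N) (tb (ar_unit T 1) 1) : N) ⊗ (tpure (M := B_A) (1 : B) c : BC)).
Lemma coind_cot_bal : balanced (fun (psi : H) (c : C) =>
  ((psi : Hom_TB TBs N) (tb (ar_unit T 1) 1) : N) ⊗ (tpure (M := B_A) (1 : B) c : BC)).
Proof.
split=> [psi psi' c|psi c c'|psi a c]; first exact: tpureDl.
  by rewrite tpureDr [LHS]tpureDr.
rewrite Hom_TB_actE ar_mul1r ar_unitR tpureA.
rewrite (_ : a *: (1 : B_l) = beta a); last exact: mulr1.
rewrite Hom_TB_beta tpureA; congr (_ ⊗ _).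
rewrite [LHS](tens_scaleE (X := B_A)) -tpureA; congr (_ ⊗ _).
by rewrite [LHS]mulr1 [RHS]mul1r.
Qed.

Lemma ev_coind_cot (w : tens H C) t :
  ev (BC_pr t) (coind_cot_fun w)
    = ((ev (pr t) w : H) : Hom_TB TBs N) (tb (ar_unit T 1) 1).
Proof.
have hb := coind_cot_bal; elim/tens_ind: w => [psi c|x y hx hy].
  rewrite [coind_cot_fun _](tlift_pure hb) ev_BC_prE ract1 -[LHS]Hom_TB_beta evE.
  rewrite Hom_TB_actE ar_mul1r [ar_unit T (pr t c)]ar_unitR tpureA.
  congr (rh_fun psi (_ ⊗ _)).
  exact: esym (mulr1 _).
by rewrite [coind_cot_fun _](tliftD hb) !evD hx hy.
Qed.

Lemma cot_coind_surj (phi : Coind_ob hP TBs N) : exists z, cot_coind z = phi.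
Proof.
case: phi => phi hphi; have [w hw] := hphi; pose z := coind_cot_fun w.
have ez t : ev (BC_pr t) z = phi (tb t 1).
  by rewrite ev_coind_cot -hw Hom_TB_actE ar_mul1r.
(* The cotensor criterion at t and s is the [S]-linearity of phi at t ⊗ 1. *)
have hz : cotensor f N z.
  apply/cotensorP => t s; rewrite !ez -(tb_actE TBs).
  exact: esym (rhZ phi (tb t 1 : TB_rmod TBs) (s : ring_of S)).
exists (exist _ z hz); apply: sub_eq; apply: rhom_TB_eq => t b.
by rewrite cot_homE ez -(rational_TBE _ _ hw).
Qed.

End Object.

Theorem Coind_Cotensor : nat_iso (Coind hP TBs) (Cotensor_BC f hP).
Proof.
apply: nat_iso_sym.
apply: (nat_iso_bij (F := Cotensor_BC f hP) (G := Coind hP TBs)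
  (phi := cot_coind_colin)).
- exact: cot_coind_inj.
- exact: cot_coind_surj.
- move=> N N' g z; apply: sub_eq; apply: rhom_TB_eq => t b.
  rewrite [LHS]cot_homE [RHS](_ : _ = g (cot_hom z (tb t b))) // cot_homE.
  by rewrite (proj2 (cl_lin g)) (ev_tmap (g := BC_pr t) _ (cl_lin g)).
Qed.

End Coinduction.

(** * Cotensor elements as values at 1 of bimodule maps *)

Section HomSop.
Hypothesis hbil : kappa_bilinear Q.

(** Bilinearity of <s, -> moves the value of [BC_pr t] on x_0 inside the bracket with x_{-1}, which
    reduces the claim to [pr_BC_lcoact]. *)
Lemma BC_pr_sop t s (x : BC) : BC_pr t (BC_sop f s x) = BC_pr (ar_mul t (xi s)) x.
Proof.
have hb := sop_bal beta P hbil s.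
rewrite -pr_BC_lcoact /BC_sop; elim/tens_ind: (BC_lcoact f x) => [d y|u v hu hv].
  by rewrite (tlift_pure hb) evE hbil; exact: proj2 (ldP (BC_pr t)) _ _.
by rewrite (tliftD hb) BC_prD hu hv evD ldD.
Qed.

Section Object.
Variable N : comodule D.

(** Paired with t, the two actions of s become the two sides of [cotensorP], and these pairings
    separate elements. *)
Lemma cotensor_sopP (z : tens N BC) :
  cotensor f N z <-> forall s, sop_l s z = sop_r f s z.
Proof.
have el s t : ev (BC_pr t) (sop_l s z) = ev (pr s) (rho (ev (BC_pr t) z)).
  by apply: (ev_tmap (g := BC_pr t) _ (act_rlin hbil N s)).
have er s t : ev (BC_pr t) (sop_r f s z) = ev (BC_pr (ar_mul t (xi s))) z.
  apply: (ev_tmap (h := id)) => // [|x]; last exact: BC_pr_sop.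
  by case: (BC_sop_bilin f hbil s).
split=> [/cotensorP h s|h].
  by apply: BC_alpha => t; rewrite el er h.
by apply/cotensorP => t s; rewrite -el -er h.
Qed.

Lemma homsop_cotensor (h : homsop_ob f hP hbil N) : cotensor f N (homsop_ev1 h).
Proof.
have [_ hl hr] := svalP h; apply/cotensor_sopP => s.
(* Both s h(1) and h(1) s equal h(s). *)
by rewrite -hl -hr mulr1 mul1r.
Qed.
Definition homsop_cot (h : homsop_ob f hP hbil N) : cot_ob f hP N :=
  exist _ (homsop_ev1 h) (homsop_cotensor h).
Lemma homsop_cot_lin : rlinear homsop_cot.
Proof. by split=> x y; exact: sub_eq. Qed.
Lemma homsop_cot_act t h :
  homsop_cot (ev (pr t) (rho h)) = ev (pr t) (rho (homsop_cot h)).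
Proof.
rewrite !ev_lift_rho; [exact: sub_eq | exact: cot_inj | exact: homsop_ev1_inj].
Qed.
Definition homsop_cot_colin : colin (homsop_ob f hP hbil N) (cot_ob f hP N) :=
  lift_colin hP homsop_cot_lin homsop_cot_act.

Lemma homsop_cot_inj : injective homsop_cot.
Proof.
move=> h k e; apply: homsop_ev1_inj.
exact: (congr1 (fun x : sub_rmod (cotensor f N) => sval x) e).
Qed.

(** Left linearity forces s |-> s z as the only candidate for a bimodule map with value z at 1. *)
Lemma sop_l_bimodule_map (z : tens N BC) : cotensor f N z ->
  Sop_bimodule_map f (fun s : (ring_of S)^c => sop_l s z).
Proof.
have aL s := act_rlin hbil N s.
have lM (s u : ring_of S) : sop_l (s * u : ring_of S) z = sop_l u (sop_l s z).
  rewrite /sop_l tmap_comp //; congr (tmap _ _ _); apply: funext => n /=.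
  exact: esym (comod_actA (Q := Q) n s u).
move=> /cotensor_sopP hz; split=> [u v|s u|u s].
- elim/tens_ind: z {hz lM} => [n x|x y hx hy].
    rewrite /sop_l !tmapE // -tpureDl; congr (_ ⊗ _).
    exact: (comod_actDr (Q := Q) n u v).
  by rewrite /sop_l !tmapD // in hx hy *; rewrite hx hy addrACA.
- exact: lM.
(* The product is that of the opposite ring, so s acts on z first; s z becomes z s by the criterion,
   and left and right actions commute. *)
- rewrite [LHS]lM hz /sop_r /sop_l tmap_swap //.
  by case: (BC_sop_bilin f hbil s).
Qed.

Lemma homsop_cot_surj (z : cot_ob f hP N) : exists h, homsop_cot h = z.
Proof.
exists (exist _ _ (sop_l_bimodule_map (svalP z))); apply: sub_eq.
rewrite /= /homsop_ev1 /= -[RHS]tmap_id; congr (tmap _ _ _).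
by apply: funext => n; exact: (comod_act1 (Q := Q) n).
Qed.

End Object.

Theorem Cotensor_HomSop : nat_iso (Cotensor_BC f hP) (HomSop_BC f hP hbil).
Proof.
apply: nat_iso_sym.
apply: (nat_iso_bij (F := HomSop_BC f hP hbil) (G := Cotensor_BC f hP)
  (phi := homsop_cot_colin)).
- exact: homsop_cot_inj.
- exact: homsop_cot_surj.
- by move=> N N' g h; exact: sub_eq.
Qed.

End HomSop.
End Corollary.

Theorem corollary4p7 (R : comNzRingType) (A B : ralg R)
  (beta : {rmorphism A -> B}) (hbeta : ralg_mor beta)
  (P : pairing A) (Q : pairing B)
  (hP : alpha_pairing P) (hQ : alpha_pairing Q)
  (f : pairing_mor beta P Q)
  (TBs : TB_structure f) :
  nat_iso (Coind hP TBs) (Cotensor_BC f hP) /\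
  (forall hbil : kappa_bilinear Q,
     nat_iso (Coind hP TBs) (Cotensor_BC f hP) /\
     nat_iso (Cotensor_BC f hP) (HomSop_BC f hP hbil)).
Proof.
have h := Coind_Cotensor hP hQ TBs.
by split=> // hbil; split=> //; exact: Cotensor_HomSop.
Qed.
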